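(* Let $S$ be a passive system node with input/state/output spaces $(\mathcal U,\mathcal X,\mathcal Y)$, transfer function $\varphi$, input map $\mathfrak B:\mathcal H_c\to\mathcal X$, and output map $\mathfrak C:\mathcal X\to\mathcal H_o$. Let $S_c$ be the controllable energy-preserving model and $S_o$ the observable co-energy-preserving model for $\varphi$. Then: 1. The input map $\mathfrak B$ intertwines $S_c$ contractively with $S$. This intertwinement is isometric if $S$ is energy preserving. $\mathfrak B$ has range dense in $\mathcal X$ if and only if $S$ is controllable. Moreover, $\mathfrak B$ is unitary if and only if $S$ is controllable and energy preserving. 2. The output map $\mathfrak C$ intertwines $S$ contractively with $S_o$. This intertwinement is co-isometric if $S$ is co-energy preserving, and $\mathfrak C$ is injective if and only if $S$ is observable. Furthermore, $\mathfrak C$ is unitary if and only if $S$ is observable and co-energy preserving. 3. In particular, the input map $\mathfrak B_o=\Gamma$ of $S_o$ intertwines $S_c$ with $S_o$. Hence, for all $\begin{bmatrix}x\\ u\end{bmatrix}\in\mathrm{dom}(S_c)$ and $\begin{bmatrix}z\\ y\end{bmatrix}=S_c\begin{bmatrix}x\\ u\end{bmatrix}$: $$(\Gamma z)(\mu)=\mu\,(\Gamma x)(\mu)+\varphi(\mu)u-y,\qquad\mu\in\mathbb C^+.$$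
   Context: All Hilbert spaces are complex; inner products are linear in the first slot; $\begin{bmatrix}\mathcal X\\ \mathcal U\end{bmatrix}$ is the orthogonal direct sum; $1$ denotes an identity operator; $\mathbb C^+=\{\operatorname{Re}\lambda>0\}$. $\mathcal U,\mathcal Y$ are separable. System nodes: a system node with input/state/output Hilbert spaces $(\mathcal U,\mathcal X,\mathcal Y)$ is a linear operator $S=\begin{bmatrix}A\&B\\ C\&D\end{bmatrix}:\begin{bmatrix}\mathcal X\\ \mathcal U\end{bmatrix}\supset\mathrm{dom}(S)\to\begin{bmatrix}\mathcal X\\ \mathcal Y\end{bmatrix}$ (rows $A\&B$, $C\&D$ defined on $\mathrm{dom}(S)$) such that $S$ and $A\&B$ are closed; the main operator $A$, $Ax=A\&B\begin{bmatrix}x\\ 0\end{bmatrix}$ with $\mathrm{dom}(A)=\{x:\begin{bmatrix}x\\ 0\end{bmatrix}\in\mathrm{dom}(S)\}$, generates a $C_0$-semigroup on $\mathcal X$; and for every $u\in\mathcal U$ there is $x$ with $\begin{bmatrix}x\\ u\end{bmatrix}\in\mathrm{dom}(S)$. For fixed $\beta\in\mathrm{res}(A)$, $\mathcal X_{-1}$ is the completion of $\mathcal X$ in the norm $\|(\beta-A)^{-1}x\|$, $A_{-1}\in\mathcal L(\mathcal X;\mathcal X_{-1})$ is the continuous extension of $A$. The control operator is the unique $B\in\mathcal L(\mathcal U;\mathcal X_{-1})$ with $A\&B=\begin{bmatrix}A_{-1}&B\end{bmatrix}|_{\mathrm{dom}(S)}$; the observation operator is $C:\mathrm{dom}(A)\to\mathcal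 Y$, $Cx=C\&D\begin{bmatrix}x\\ 0\end{bmatrix}$; the transfer function is $\lambda\mapsto C\&D\begin{bmatrix}(\lambda-A_{-1})^{-1}B\\ 1\end{bmatrix}$. The adjoint $S^*$ is a system node with input space $\mathcal Y$ and output space $\mathcal U$. $S$ is passive if $2\operatorname{Re}\langle z,x\rangle\le\|u\|^2-\|y\|^2$ for all $\begin{bmatrix}x\\ u\end{bmatrix}\in\mathrm{dom}(S)$, $\begin{bmatrix}z\\ y\end{bmatrix}=S\begin{bmatrix}x\\ u\end{bmatrix}$; energy preserving if equality always holds; co-energy preserving if $S^*$ is energy preserving. For passive $S$, $\mathbb C^+\subset\mathrm{res}(A)$ and the transfer function, restricted to $\mathbb C^+$, is a Schur function (analytic, contraction-valued in $\mathcal L(\mathcal U;\mathcal Y)$). A passive $S$ is controllable if the vectors $(\lambda-A_{-1})^{-1}B\nu$ ($\lambda\in\mathbb C^+$, $\nu\in\mathcal U$) have dense linear span in $\mathcal X$, and observable if $\bigcap_{\lambda\in\mathbb C^+}\ker(C(\lambda-A)^{-1})=\{0\}$. Spaces: $\mathcal H_o$ and $\mathcal H_c$ are the RKHSs of, respectively, $\mathcal Y$- and $\mathcal U$-valued analytic functions on $\mathbb C^+$ with reproducing kernels $K_o(\mu,\lambda)=\frac{1-\varphi(\mu)\varphi(\lambda)^*}{\mu+\overline\lambda}$ and $K_c(\mu,\lambda)=\frac{1-\varphi(\overline\mu)^*\varphi(\overline\lambda)}{\mu+\overline\lambda}$; $e_o(\lambda),e_c(\lambda)$ are point evaluations, so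 $e_c(\lambda)^*\nu=K_c(\cdot,\lambda)\nu$. Input/output maps of a passive $S$: $\mathfrak C:\mathcal X\to\mathcal H_o$ is the contraction $(\mathfrak Cx)(\mu)=C(\mu-A)^{-1}x$, and $\mathfrak B:\mathcal H_c\to\mathcal X$ is the unique contraction with $\mathfrak Be_c(\overline\lambda)^*\nu=(\lambda-A_{-1})^{-1}B\nu$, $\lambda\in\mathbb C^+$, $\nu\in\mathcal U$. The past/future map is $\Gamma=\mathfrak C\mathfrak B:\mathcal H_c\to\mathcal H_o$; it depends only on $\varphi$: $(\Gamma e_c(\overline{\lambda_*})^*\nu)(\mu)=\frac{\varphi(\lambda_* )-\varphi(\mu)}{\mu-\lambda_*}\nu$. Models: $S_c:\begin{bmatrix}\mathcal H_c\\ \mathcal U\end{bmatrix}\supset\mathrm{dom}(S_c)\to\begin{bmatrix}\mathcal H_c\\ \mathcal Y\end{bmatrix}$ is the extension by linearity and operator closure of $\begin{bmatrix}e_c(\overline\lambda)^*\nu\\ \nu\end{bmatrix}\mapsto\begin{bmatrix}\lambda e_c(\overline\lambda)^*\nu\\ \varphi(\lambda)\nu\end{bmatrix}$, $\lambda\in\mathbb C^+,\nu\in\mathcal U$. $S_o:\begin{bmatrix}\mathcal H_o\\ \mathcal U\end{bmatrix}\supset\mathrm{dom}(S_o)\to\begin{bmatrix}\mathcal H_o\\ \mathcal Y\end{bmatrix}$ has as domain all $\begin{bmatrix}x\\ u\end{bmatrix}$ for which there is a (necessarily unique) $y\in\mathcal Y$ such that $z(\mu):=\mu x(\mu)+\varphi(\mu)u-y$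 defines an element of $\mathcal H_o$, and then $S_o\begin{bmatrix}x\\ u\end{bmatrix}=\begin{bmatrix}z\\ y\end{bmatrix}$. Both are passive system nodes with transfer function $\varphi$; $S_c$ is controllable and energy preserving, $S_o$ is observable and co-energy preserving. Intertwinement: for system nodes $S_0,S_1$ with state spaces $\mathcal X_0,\mathcal X_1$ and the same input and output spaces, $E\in\mathcal L(\mathcal X_0;\mathcal X_1)$ intertwines $S_0$ with $S_1$ if $\begin{bmatrix}E&0\\ 0&1\end{bmatrix}\mathrm{dom}(S_0)\subset\mathrm{dom}(S_1)$ and $\begin{bmatrix}E&0\\ 0&1\end{bmatrix}S_0=S_1\begin{bmatrix}E&0\\ 0&1\end{bmatrix}\Big|_{\mathrm{dom}(S_0)}$; the intertwinement is contractive, isometric, co-isometric if $E$ is. *)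

(* Defs.v *)
From HB Require Import structures.
From mathcomp Require Import all_boot all_order all_algebra.
From mathcomp Require Import complex.
From mathcomp Require Import boolp classical_sets functions cardinality reals.
From mathcomp Require Import topology normedtype derive.

Set Implicit Arguments.
Unset Strict Implicit.
Unset Printing Implicit Defensive.

Import Order.TTheory GRing.Theory Num.Theory numFieldNormedType.Exports.

Local Open Scope classical_set_scope.
Local Open Scope ring_scope.

(* Complex Hilbert spaces. The form [inner] is linear in its first argument;
   norms take values in R[i], where x <= y means that y - x is a nonnegative
   real, and 'Re : R[i] -> R[i] is real-valued. *)
HB.mixin Record CompleteNormedModule_isHilbert (R : realType) V
    of CompleteNormedModule R[i] V := {
  inner : {dot V for (@Num.conj R[i])} ;
  inner_normE : forall x : V, inner x x = `|x| ^+ 2 }.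

#[short(type="hilbertType")]
HB.structure Definition Hilbert (R : realType) :=
  {V of CompleteNormedModule R[i] V & CompleteNormedModule_isHilbert R V}.

Definition separable_space (T : topologicalType) : Prop :=
  exists D : set T, countable D /\ dense D.

Definition Cplus (R : realType) : set R[i] := [set l : R[i] | 0 < 'Re l].
Arguments Cplus {R}.

Definition lin_subspace (K : numFieldType) (V : lmodType K) (G : set V) : Prop :=
  G 0 /\ forall (a : K) (x y : V), G x -> G y -> G (a *: x + y).

Definition lspan (K : numFieldType) (V : lmodType K) (G : set V) : set V :=
  smallest (@lin_subspace K V) G.

Section BoundedOperators.
Context {R : realType} {V W : hilbertType R}.

Definition contractive (E : V -> W) : Prop := forall x, `|E x| <= `|x|.

Definition isometric (E : V -> W) : Prop := forall x, `|E x| = `|x|.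

(* The Hilbert space adjoint; the default value 0 is not used when E is
   linear and bounded. *)
Definition adjoint (E : V -> W) (w : W) : V :=
  xget 0 [set v | forall x, inner (E x) w = inner x v].

Definition unitary (E : V -> W) : Prop :=
  cancel E (adjoint E) /\ cancel (adjoint E) E.

End BoundedOperators.

Definition coisometric {R : realType} {V W : hilbertType R} (E : V -> W) :=
  isometric (adjoint E).

(* Operators that need not be everywhere defined are represented by their
   graphs. *)
Section PartialOperators.
Context {K : numFieldType} {V W : lmodType K}.

Definition partial_linear (G : set (V * W)) : Prop :=
  lin_subspace G /\ forall x y y', G (x, y) -> G (x, y') -> y = y'.

Definition op_dom (G : set (V * W)) : set V := [set x | exists y, G (x, y)].

Definition op_app (G : set (V * W)) (x : V) : W := xget 0 [set y | G (x, y)].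

End PartialOperators.

Section Semigroups.
Context {R : realType} {X : hilbertType R}.

Definition C0_semigroup (T : R -> {linear X -> X}) : Prop :=
  [/\ forall t, 0 <= t -> continuous (T t),
      forall x, T 0 x = x,
      forall s t x, 0 <= s -> 0 <= t -> T (s + t) x = T s (T t x) &
      forall x, T t x @[t --> 0^'+] --> x].

Definition sg_generator (T : R -> {linear X -> X}) : set (X * X) :=
  [set p | ((h^-1)%:C)%C *: (T h p.1 - p.1) @[h --> 0^'+] --> p.2].

Definition generates_C0_semigroup (A : set (X * X)) : Prop :=
  exists T, C0_semigroup T /\ A = sg_generator T.

Definition resolvent_set (A : set (X * X)) : set R[i] :=
  [set l | exists Q : {linear X -> X},
    [/\ continuous Q,
        forall w, A (Q w, l *: Q w - w) &
        forall x z, A (x, z) -> Q (l *: x - z) = x]].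

(* (l - A)^-1 w *)
Definition resolvent (A : set (X * X)) (l : R[i]) (w : X) : X :=
  xget 0 [set x | exists2 z, A (x, z) & l *: x - z = w].

End Semigroups.

Section SystemNodes.
Context {R : realType} {U X Y : hilbertType R}.
Implicit Type S : set ((X * U) * (X * Y)).

(* The rows A&B and C&D *)
Definition AB_row S : set ((X * U) * X) :=
  [set p | exists y, S (p.1, (p.2, y))].

Definition CD_row S : set ((X * U) * Y) :=
  [set p | exists z, S (p.1, (z, p.2))].

Definition main_op S : set (X * X) := [set p | AB_row S ((p.1, 0), p.2)].

Definition observation_op S : set (X * Y) :=
  [set p | CD_row S ((p.1, 0), p.2)].

Definition system_node S : Prop :=
  [/\ partial_linear S,
      closed S,
      closed (AB_row S),
      generates_C0_semigroup (main_op S) &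
      forall u, exists x, op_dom S (x, u)].

Definition passive S : Prop :=
  forall x u z y, S ((x, u), (z, y)) ->
    2 * 'Re (inner z x) <= `|u| ^+ 2 - `|y| ^+ 2.

Definition energy_preserving S : Prop :=
  forall x u z y, S ((x, u), (z, y)) ->
    2 * 'Re (inner z x) = `|u| ^+ 2 - `|y| ^+ 2.

Definition node_adjoint S : set ((X * Y) * (X * U)) :=
  [set q | forall p, S p ->
    inner p.2.1 q.1.1 + inner p.2.2 q.1.2 =
    inner p.1.1 q.2.1 + inner p.1.2 q.2.2].

(* Since (l - A)^-1 is only used for l in the right half-plane, which lies in
   the resolvent set of the main operator of a passive system node, C (l-A)^-1
   is everywhere defined. *)
Definition output_resolvent S (l : R[i]) (x : X) : Y :=
  op_app (observation_op S) (resolvent (main_op S) l x).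

Definition observable S : Prop :=
  \bigcap_(l in Cplus) [set x | output_resolvent S l x = 0] = [set 0].

End SystemNodes.

Definition co_energy_preserving {R : realType} {U X Y : hilbertType R}
    (S : set ((X * U) * (X * Y))) : Prop :=
  energy_preserving (node_adjoint S).

(* The completion X_{-1} of X in the norm |(beta - A)^-1 x|, where [xm1_inj]
   embeds X densely into X_{-1}, together with the continuous extension A_{-1}
   of A. *)
Record extrapolation_space {R : realType} {X : hilbertType R}
    (A : set (X * X)) := ExtrapolationSpace {
  xm1_beta : R[i] ;
  xm1_beta_res : resolvent_set A xm1_beta ;
  xm1 :> completeNormedModType R[i] ;
  xm1_inj : {linear X -> xm1} ;
  xm1_norm : forall x, `|xm1_inj x| = `|resolvent A xm1_beta x| ;
  xm1_dense : dense (range xm1_inj) ;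
  xm1_op : {linear X -> xm1} ;
  xm1_op_continuous : continuous xm1_op ;
  xm1_op_ext : forall x z, A (x, z) -> xm1_op x = xm1_inj z }.

Section ControlOperator.
Context {R : realType} {U X Y : hilbertType R}.
Variables (S : set ((X * U) * (X * Y))) (E : extrapolation_space (main_op S)).
Variable B : {linear U -> E}.

Definition control_op : Prop :=
  continuous B /\
  forall x u z, AB_row S ((x, u), z) -> xm1_inj E z = xm1_op E x + B u.

(* (l - A_{-1})^-1 B nu *)
Definition input_resolvent (l : R[i]) (nu : U) : X :=
  xget 0 [set x | l *: xm1_inj E x - xm1_op E x = B nu].

Definition transfer (l : R[i]) (nu : U) : Y :=
  op_app (CD_row S) (input_resolvent l nu, nu).

Definition controllable : Prop :=
  dense (lspan [set x | exists l nu, Cplus l /\ x = input_resolvent l nu]).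

End ControlOperator.

(* H, with point evaluations [ev], is the reproducing kernel Hilbert space of
   W-valued analytic functions on the right half-plane with kernel K; the
   values of [ev] outside of the half-plane are irrelevant. The second clause
   says that an element of H is determined by the function it represents. *)
Definition is_rkhs {R : realType} {H W : hilbertType R}
    (ev : R[i] -> {linear H -> W}) (K : R[i] -> R[i] -> W -> W) : Prop :=
  [/\ forall f (m : R[i]^o), Cplus m ->
        derivable (fun n : R[i]^o => ev n f) m 1,
      forall f g, (forall m, Cplus m -> ev m f = ev m g) -> f = g &
      forall l nu, Cplus l -> exists k,
        (forall m, Cplus m -> ev m k = K m l nu) /\
        (forall f, inner f k = inner (ev l f) nu)].

Section Models.
Context {R : realType} {U Y : hilbertType R}.
Variable phi : R[i] -> U -> Y.

Definition kernel_o (m l : R[i]) (gam : Y) : Y :=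
  (m + l^*)^-1 *: (gam - phi m (adjoint (phi l) gam)).

Definition kernel_c (m l : R[i]) (nu : U) : U :=
  (m + l^*)^-1 *: (nu - adjoint (phi (m^*)) (phi (l^*) nu)).

Definition model_c {Hc : hilbertType R} (ec : R[i] -> {linear Hc -> U}) :
    set ((Hc * U) * (Hc * Y)) :=
  closure (lspan [set p | exists l nu, Cplus l /\
    let k := adjoint (ec (l^*)) nu in p = ((k, nu), (l *: k, phi l nu))]).

Definition model_o {Ho : hilbertType R} (eo : R[i] -> {linear Ho -> Y}) :
    set ((Ho * U) * (Ho * Y)) :=
  [set p | forall m, Cplus m ->
    eo m p.2.1 = m *: eo m p.1.1 + phi m p.1.2 - p.2.2].

End Models.

Definition is_input_map {R : realType} {U X Y Hc : hilbertType R}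
    (S : set ((X * U) * (X * Y))) (E : extrapolation_space (main_op S))
    (B : {linear U -> E}) (ec : R[i] -> {linear Hc -> U})
    (frakB : {linear Hc -> X}) : Prop :=
  contractive frakB /\
  forall l nu, Cplus l ->
    frakB (adjoint (ec (l^*)) nu) = input_resolvent B l nu.

Definition is_output_map {R : realType} {U X Y Ho : hilbertType R}
    (S : set ((X * U) * (X * Y))) (eo : R[i] -> {linear Ho -> Y})
    (frakC : {linear X -> Ho}) : Prop :=
  contractive frakC /\
  forall x m, Cplus m -> eo m (frakC x) = output_resolvent S m x.

(* [diag1 E] is the block diagonal operator with entries E and 1. *)
Definition diag1 {X0 X1 W : Type} (E : X0 -> X1) (p : X0 * W) : X1 * W :=
  (E p.1, p.2).

Definition intertwines {R : realType} {U X0 X1 Y : hilbertType R}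
    (S0 : set ((X0 * U) * (X0 * Y))) (S1 : set ((X1 * U) * (X1 * Y)))
    (E : {linear X0 -> X1}) : Prop :=
  [/\ continuous E,
      diag1 E @` op_dom S0 `<=` op_dom S1 &
      forall w, op_dom S0 w -> diag1 E (op_app S0 w) = op_app S1 (diag1 E w)].

(* Main.v *)
Require Import Defs.
From HB Require Import structures.
From mathcomp Require Import all_boot all_order all_algebra.
From mathcomp Require Import complex.
From mathcomp Require Import boolp classical_sets functions cardinality reals.
From mathcomp Require Import topology normedtype derive.
From mathcomp Require Import prodnormedzmodule ring lra.
Set Implicit Arguments.
Unset Strict Implicit.
Unset Printing Implicit Defensive.
Import Order.TTheory GRing.Theory Num.Theory numFieldNormedType.Exports.
Local Open Scope classical_set_scope.
Local Open Scope ring_scope.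

(* A node is handled through its graph.  With the indefinite form
   [p, q] = <z, x'> + <x, z'> - <u, u'> + <y, y'> on graph elements, energy
   preservation says that the graph is neutral, and passivity that the form is
   nonpositive on it.  A passive graph whose Cayley transform
   (x - z, u) |-> (x + z, y) is everywhere defined is maximal passive and has
   a passive adjoint.  The Gram identity of the kernel functions is exactly
   neutrality of the generators of S_c (and of the dual generators, whose
   adjoint contains S_o), and it carries over through B and C^*.
   B intertwines because the generators of S_c are mapped into the closed graph
   of S; C intertwines by the resolvent identity
   C(m - A)^-1 (m x - z) = y - phi(m) u on S.  If B is unitary, the image of the
   generators spans a closed neutral graph with full Cayley transform inside S,
   so it equals S, which is then energy preserving; the same argument with
   C^* and the adjoint of S settles the second part. *)

(** * Real norms, closures and closed ranges *)

(** The main obstacle is that the resolvent of the main operator [A] must be available on the whole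
    right half-plane, while a node only provides a semigroup. Passivity makes [A] dissipative, so
    [l - A] is bounded below; density of its range is extracted from the semigroup, since a vector
    orthogonal to the range would have unbounded pairings with bounded orbits. Short-time
    contractivity of the orbits comes from uniform boundedness and Euler steps, without integrating
    orbits. The extrapolation space enters through the injectivity of [l - A_{-1}] on the state
    space: it identifies the vector [(l - A_{-1})^-1 B nu] with the state [x] of the graph element
    that has input [nu] and derivative [l *: x]. Everything else then happens in graphs. The Cayley
    transform is taken at 1, where the generator with index [l] contributes the factor [1 - l]. The
    index 1 is therefore lost, and the kernel functions with the remaining indices still separate
    because elements of the kernel spaces are continuous. For [S_o], the input map is identified
    from three facts: its graph element is explicit, its main operator has dense domain, and [l - A]
    is injective there. *)

Section ComplexNumbers.
Variable R : realType.
Implicit Types a b : R[i].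

Lemma RecD a b : complex.Re (a + b) = complex.Re a + complex.Re b.
Proof. by case: a b => [? ?] [? ?]. Qed.

Lemma RecN a : complex.Re (- a) = - complex.Re a.
Proof. by case: a. Qed.

Lemma RecB a b : complex.Re (a - b) = complex.Re a - complex.Re b.
Proof. by rewrite RecD RecN. Qed.

Lemma RecZ (r : R) a : complex.Re (r%:C%C * a) = r * complex.Re a.
Proof. by case: a => x y /=; rewrite mul0r subr0. Qed.

Lemma RecJ a : complex.Re a^* = complex.Re a.
Proof. by case: a. Qed.

Lemma le_Rec a b : a <= b -> complex.Re a <= complex.Re b.
Proof. by rewrite lecE => /andP[]. Qed.

Lemma CplusE a : Cplus a <-> 0 < complex.Re a.
Proof. by rewrite /Cplus /= -complexRe ltcR. Qed.

Lemma Cplus1 : Cplus (1 : R[i]).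
Proof. by apply/CplusE. Qed.

Lemma CplusJ a : Cplus a -> Cplus a^*.
Proof. by move=> /CplusE ?; apply/CplusE; rewrite RecJ. Qed.

Lemma CplusD_neq0 a b : Cplus a -> Cplus b -> a + b != 0.
Proof.
move=> /CplusE a0 /CplusE b0; apply/eqP => /(congr1 (@complex.Re R)).
by rewrite RecD /= => ab; lra.
Qed.

Lemma conjcc a : (a^*)^* = a.
Proof. exact: conjCK. Qed.

End ComplexNumbers.

Section RealNorm.
Variables (R : realType).
Implicit Types V W : normedModType R[i].

(** The norms of the hierarchy are [R[i]]-valued; [cmod] and [nrm] are their real parts, which opens
    estimates to arithmetic over the ordered field [R]. *)
Definition cmod (a : R[i]) : R := complex.Re `|a|.

Lemma cmodE (a : R[i]) : `|a| = (cmod a)%:C%C.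
Proof. by rewrite /cmod RRe_real // ger0_real. Qed.

Definition nrm V (x : V) : R := complex.Re `|x|.

Lemma nrmE V (x : V) : `|x| = (nrm x)%:C%C.
Proof. by rewrite /nrm RRe_real // ger0_real. Qed.

Lemma nrm_ge0 V (x : V) : 0 <= nrm x.
Proof. by rewrite -ler0c -nrmE. Qed.

Lemma nrm0 V : nrm (0 : V) = 0.
Proof. by rewrite /nrm normr0. Qed.

Lemma nrm_eq0 V (x : V) : nrm x = 0 -> x = 0.
Proof. by move=> x0; apply/eqP; rewrite -normr_eq0 nrmE x0. Qed.

Lemma nrm_le0 V (x : V) : nrm x <= 0 -> x = 0.
Proof. by move=> x0; apply: nrm_eq0; apply/eqP; rewrite eq_le x0 nrm_ge0. Qed.

Lemma nrmN V (x : V) : nrm (- x) = nrm x.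
Proof. by rewrite /nrm normrN. Qed.

Lemma nrmB V (x y : V) : nrm (x - y) = nrm (y - x).
Proof. by rewrite -nrmN opprB. Qed.

Lemma nrmD V (x y : V) : nrm (x + y) <= nrm x + nrm y.
Proof. by rewrite -lecR rmorphD /= -!nrmE ler_normD. Qed.

Lemma nrmBD V (z x y : V) : nrm (x - y) <= nrm (x - z) + nrm (z - y).
Proof. by rewrite -(subrKA z) nrmD. Qed.

Lemma nrm_lipschitz V (x y : V) : nrm x <= nrm y + nrm (x - y).
Proof. by rewrite -{1}(subrK y x) addrC nrmD. Qed.

Lemma nrmZ V (a : R[i]) (x : V) : nrm (a *: x) = cmod a * nrm x.
Proof. by rewrite /nrm normrZ nrmE cmodE -rmorphM. Qed.

Lemma nrmZr V (a : R) (x : V) : nrm (a%:C%C *: x) = `|a| * nrm x.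
Proof. by rewrite nrmZ /cmod normc_def /= expr0n addr0 sqrtr_sqr. Qed.

Lemma nrm_double V (x : V) : nrm (x + x) = 2 * nrm x.
Proof.
have -> : x + x = (2 : R)%:C%C *: x by rewrite rmorph_nat scaler_nat.
by rewrite nrmZr ger0_norm.
Qed.

Lemma cmod_ge0 (a : R[i]) : 0 <= cmod a.
Proof. by rewrite -ler0c -cmodE. Qed.

Lemma cmod_lipschitz (a b : R[i]) : cmod a <= cmod (a + b) + cmod b.
Proof. by rewrite -RecD; apply: le_Rec; rewrite -{1}(addrK b a) ler_normB. Qed.

Lemma cmod_gt0 (a : R[i]) : a != 0 -> 0 < cmod a.
Proof. by rewrite -normr_gt0 cmodE ltcR. Qed.

Lemma Rec_le_cmod (a : R[i]) : complex.Re a <= cmod a.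
Proof.
by apply: le_trans (ler_norm _) _; rewrite -lecR -cmodE; exact: normc_ge_Re.
Qed.

Lemma nrm_pairE V W (x : V) (y : W) : nrm (x, y) = Num.max (nrm x) (nrm y).
Proof.
rewrite /nrm ProdNormedZmodule.prod_normE /= !nrmE.
case: (leP (nrm x) (nrm y)) => [|/ltW] xy.
  by rewrite max_r ?lecR.
by rewrite max_l ?lecR.
Qed.

Lemma nrm_pairl V W (x : V) (y : W) : nrm x <= nrm (x, y).
Proof. by rewrite nrm_pairE le_max lexx. Qed.

Lemma nrm_pairr V W (x : V) (y : W) : nrm y <= nrm (x, y).
Proof. by rewrite nrm_pairE le_max lexx orbT. Qed.

Lemma nrm_fst V W (p : V * W) : nrm p.1 <= nrm p.
Proof. by case: p => x y; exact: nrm_pairl. Qed.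

Lemma nrm_snd V W (p : V * W) : nrm p.2 <= nrm p.
Proof. by case: p => x y; exact: nrm_pairr. Qed.

Lemma nrm_pair V W (x : V) (y : W) : nrm (x, y) <= nrm x + nrm y.
Proof. by rewrite nrm_pairE ge_max lerDl lerDr !nrm_ge0. Qed.

Lemma nrm_ballP V (x : V) (A : set V) :
  nbhs x A <-> exists2 e : R, 0 < e & forall y, nrm (x - y) < e -> A y.
Proof.
split=> [/nbhs_normP[e /= e0 eA]|[e e0 eA]].
  have eE : e = (complex.Re e)%:C%C by rewrite RRe_real // gtr0_real.
  exists (complex.Re e) => [|y xy]; first by rewrite -ltcR -eE.
  by apply: eA; rewrite /= nrmE eE ltcR.
apply/nbhs_normP; exists e%:C%C => /=; first by rewrite ltcR.
by move=> y /=; rewrite nrmE ltcR; exact: eA.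
Qed.

Lemma closure_nrmP V (A : set V) (x : V) :
  closure A x <-> forall e : R, 0 < e -> exists2 y, A y & nrm (x - y) < e.
Proof.
split=> [cAx e e0|Ax B /nrm_ballP[e e0 eB]].
  have [|y [Ay xy]] := cAx [set y | nrm (x - y) < e]; last by exists y.
  by apply/nrm_ballP; exists e.
by have [y Ay xy] := Ax e e0; exists y; split=> //; exact: eB.
Qed.

Lemma dense_nrmP V (A : set V) :
  dense A <-> forall x (e : R), 0 < e -> exists2 y, A y & nrm (x - y) < e.
Proof.
split=> [dA x e e0|Ax O [x Ox] Oo].
  have nx : nbhs x [set y | nrm (x - y) < e] by apply/nrm_ballP; exists e.
  have [||y [/interior_subset xy Ay]] := dA (interior [set y | nrm (x - y) < e]).
  - by exists x.
  - exact: open_interior.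
  - by exists y.
have /nrm_ballP[e e0 eO] : nbhs x O by exact: open_nbhs_nbhs.
by have [y Ay xy] := Ax x e e0; exists y; split=> //; exact: eO.
Qed.

Lemma closed_nrmP V (A : set V) :
  (forall x, (forall e : R, 0 < e -> exists2 y, A y & nrm (x - y) < e) -> A x) ->
  closed A.
Proof. by move=> cA x /closure_nrmP; exact: cA. Qed.

Lemma continuous_nrmP V W (f : V -> W) :
  continuous f <-> forall x (e : R), 0 < e ->
    exists2 d : R, 0 < d & forall y, nrm (x - y) < d -> nrm (f x - f y) < e.
Proof.
split=> [cf x e e0|cf x A /nrm_ballP[e e0 eA]].
  have /(cf x) : nbhs (f x) [set y | nrm (f x - y) < e].
    by apply/nrm_ballP; exists e.
  by move=> /nrm_ballP.
have [d d0 dP] := cf x e e0.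
by apply/nrm_ballP; exists d => // y /dP; exact: eA.
Qed.

Lemma lipschitz_continuous V W (f : V -> W) (C : R) :
  (forall x y, nrm (f x - f y) <= C * nrm (x - y)) -> continuous f.
Proof.
move=> fC; apply/continuous_nrmP => x e e0.
(* [C] carries no sign condition, so [|C| + 1] serves as a strictly positive substitute. *)
have C0 : 0 < `|C| + 1 by rewrite ltr_wpDl.
exists (e / (`|C| + 1)) => [|y]; first by rewrite divr_gt0.
rewrite ltr_pdivlMr // => xye.
have Cn : C <= `|C| by exact: ler_norm.
have := fC x y; have := nrm_ge0 (x - y); nra.
Qed.

Lemma contractive_nrm (V W : hilbertType R) (f : V -> W) :
  contractive f <-> forall x, nrm (f x) <= nrm x.
Proof.
by split=> fC x; have := fC x; rewrite !nrmE lecR.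
Qed.

Lemma isometric_nrm (V W : hilbertType R) (f : V -> W) :
  isometric f <-> forall x, nrm (f x) = nrm x.
Proof.
split=> fC x; have := fC x; first by rewrite /nrm => ->.
by rewrite !nrmE => ->.
Qed.

Lemma nrm_small V (x : V) : (forall e : R, 0 < e -> nrm x < e) -> x = 0.
Proof.
move=> xe; apply: nrm_le0; rewrite leNgt; apply/negP => /xe.
by rewrite ltxx.
Qed.

Lemma cauchy_nrm_cvg (V : completeNormedModType R[i]) (u : nat -> V) :
  (forall e : R, 0 < e -> exists N, forall n m, (N <= n)%N -> (N <= m)%N ->
    nrm (u n - u m) < e) ->
  exists l, forall e : R, 0 < e -> exists N, forall n, (N <= n)%N -> nrm (u n - l) < e.
Proof.
move=> uC.
have /cauchy_cvgP : cauchy (u @ \oo).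
  apply/cauchyP => e e0.
  have eE : e = (complex.Re e)%:C%C by rewrite RRe_real // gtr0_real.
  have [|N uN] := uC (complex.Re e); first by rewrite -ltcR -eE.
  exists (u N), N => // n /= Nn.
  rewrite -ball_normE /= nrmE eE ltcR; exact: uN.
move=> /cvg_ex[l ul]; exists l => e e0.
have /ul[N _ NP] : nbhs l [set y | nrm (y - l) < e].
  by apply/nrm_ballP; exists e => // y; rewrite nrmB.
by exists N => n /NP.
Qed.

Lemma nrm_cvgP V T (F : set_system T) (FF : Filter F) (f : T -> V) l :
  f @ F --> l <-> forall e : R, 0 < e -> \forall t \near F, nrm (l - f t) < e.
Proof.
split=> [fl e e0|fl A /nrm_ballP[e e0 eA]].
  by apply: (fl [set y | nrm (l - y) < e]); apply/nrm_ballP; exists e.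
by apply: filterS (fl e e0) => t /eA.
Qed.

End RealNorm.

Section ClosedRange.
Variable R : realType.
Implicit Types V W : normedModType R[i].

(** A property rather than a structure: the graph spaces to which it is applied are products, for
    which it is assembled componentwise. *)
Definition nrm_complete V := forall u : nat -> V,
  (forall e : R, 0 < e -> exists N, forall n m, (N <= n)%N -> (N <= m)%N ->
    nrm (u n - u m) < e) ->
  exists l, forall e : R, 0 < e -> exists N, forall n, (N <= n)%N -> nrm (u n - l) < e.

Lemma nrm_complete_pair V W : nrm_complete V -> nrm_complete W -> nrm_complete (V * W)%type.
Proof.
move=> Vc Wc u uC.
have [|l lP] := Vc (fst \o u).
  move=> e /uC[N NP]; exists N => n m Nn Nm; apply: le_lt_trans (NP n m Nn Nm).
  by rewrite /=; case: (u n) (u m) => [a b] [c d]; exact: (nrm_pairl (a - c) (b - d)).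
have [|k kP] := Wc (snd \o u).
  move=> e /uC[N NP]; exists N => n m Nn Nm; apply: le_lt_trans (NP n m Nn Nm).
  by rewrite /=; case: (u n) (u m) => [a b] [c d]; exact: (nrm_pairr (a - c) (b - d)).
exists (l, k) => e e0; have [N NP] := lP e e0; have [N' NP'] := kP e e0.
exists (maxn N N') => n; rewrite geq_max => /andP[nN nN'].
have -> : u n - (l, k) = ((u n).1 - l, (u n).2 - k) by case: (u n).
by rewrite nrm_pairE gt_max; apply/andP; split; [exact: NP|exact: NP'].
Qed.

Lemma inv_nat_small (e : R) : 0 < e ->
  exists N, forall n, (N <= n)%N -> n.+1%:R^-1 < e.
Proof.
move=> e0; exists (Num.truncn e^-1) => n Nn.
rewrite -[e]invrK ltf_pV2 ?posrE ?invr_gt0 //.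
by apply: lt_le_trans (truncnS_gt _) _; rewrite ler_nat.
Qed.

(** The lower bound turns approximate preimages into a Cauchy sequence; its limit stays in the
    closed set [M], and the upper bound identifies its image. *)
Lemma closed_range V W (M : set V) (T : V -> W) (C K : R) :
  nrm_complete V -> lin_subspace M -> closed M ->
  (forall x y, T (x - y) = T x - T y) ->
  (forall x, nrm (T x) <= K * nrm x) ->
  (forall x, M x -> nrm x <= C * nrm (T x)) ->
  forall w, closure (T @` M) w -> (T @` M) w.
Proof.
move=> Vc [M0 Ml] Mc TB TK TC w /closure_nrmP Tw.
have step (n : nat) : exists x, M x /\ nrm (w - T x) < n.+1%:R^-1.
  by have [|_ [x Mx <-] xw] := Tw (n.+1%:R^-1); [rewrite invr_gt0|exists x].
have [u uP] := choice step.
have C0 : 0 < `|C| + 1 by rewrite ltr_wpDl.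
have K0 : 0 < `|K| + 1 by rewrite ltr_wpDl.
have [|l lP] := Vc u.
  move=> e e0; have [|N NP] := @inv_nat_small (e / 2 / (`|C| + 1)).
    by rewrite !divr_gt0.
  exists N => n m Nn Nm.
  have /TC : M (u n - u m).
    by rewrite addrC -scaleN1r; apply: Ml; [exact: (uP m).1|exact: (uP n).1].
  rewrite TB => h.
  have h2 := nrmBD w (T (u n)) (T (u m)); rewrite (nrmB _ w) in h2.
  have a1 := lt_trans (uP n).2 (NP n Nn); have a2 := lt_trans (uP m).2 (NP m Nm).
  rewrite ltr_pdivlMr // in a1; rewrite ltr_pdivlMr // in a2.
  have := ler_norm C; have := nrm_ge0 (T (u n) - T (u m)); nra.
have Ml' : M l.
  apply: Mc; apply/closure_nrmP => e /lP[N NP].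
  by exists (u N); [exact: (uP N).1|rewrite nrmB NP].
exists l => //; apply/eqP; rewrite -subr_eq0; apply/eqP/nrm_small => e e0.
have [|N NP] := lP (e / 2 / (`|K| + 1)); first by rewrite !divr_gt0.
have [|N' NP'] := @inv_nat_small (e / 2); first by rewrite divr_gt0.
have a1 := NP _ (leq_maxl N N'); have a2 := NP' _ (leq_maxr N N').
have a3 := (uP (maxn N N')).2; have {a2 a3} := lt_trans a3 a2.
move: (maxn N N') a1 => n a1.
have := nrmBD (T (u n)) (T l) w; rewrite -TB (nrmB (T (u n)) w).
rewrite ltr_pdivlMr // in a1.
have := TK (l - u n); rewrite (nrmB l).
have := ler_norm K; have := nrm_ge0 (u n - l); nra.
Qed.

Lemma closed_kernel V (f : V -> R[i]) (C : R) :
  (forall x y, f (x - y) = f x - f y) -> (forall x, cmod (f x) <= C * nrm x) ->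
  closed [set x | f x = 0].
Proof.
move=> fB fC; apply: closed_nrmP => x xK /=.
suff : cmod (f x) <= 0.
  move=> h; apply/eqP; rewrite -normr_eq0 cmodE; apply/eqP; congr (_%:C%C).
  by apply/eqP; rewrite eq_le h cmod_ge0.
rewrite leNgt; apply/negP => fx.
have C0 : 0 < `|C| + 1 by rewrite ltr_wpDl.
have [|y /= fy xy] := xK (cmod (f x) / (`|C| + 1)); first by rewrite divr_gt0.
have := fC (x - y); rewrite fB fy subr0.
rewrite ltr_pdivlMr // in xy.
have := ler_norm C; have := nrm_ge0 (x - y); nra.
Qed.

Lemma lin_subspace_closure V (M : set V) : lin_subspace M -> lin_subspace (closure M).
Proof.
move=> [M0 Ml]; split=> [|a x y /closure_nrmP Mx /closure_nrmP My].
  exact: subset_closure.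
apply/closure_nrmP => e e0.
have c0 : 0 < cmod a + 1 by rewrite ltr_wpDl ?cmod_ge0.
have [|x' Mx' xx'] := Mx (e / 2 / (cmod a + 1)); first by rewrite !divr_gt0.
have [|y' My' yy'] := My (e / 2); first by rewrite divr_gt0.
exists (a *: x' + y'); first exact: Ml.
rewrite opprD addrACA -scalerBr.
apply: le_lt_trans (nrmD _ _) _; rewrite nrmZ.
rewrite ltr_pdivlMr // in xx'.
have := cmod_ge0 a; have := nrm_ge0 (x - x'); nra.
Qed.

Lemma closure_sub V (M N : set V) : closed N -> M `<=` N -> closure M `<=` N.
Proof. by move=> Nc MN; rewrite [N](closure_id _).1 //; exact: closureS. Qed.

End ClosedRange.

Section Spans.
Variables (K : numFieldType) (V : lmodType K).
Implicit Types G N : set V.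

Lemma lspan_lin G : lin_subspace (lspan G).
Proof.
split=> [N [[N0 _] _] //|a x y Gx Gy N NP].
by apply: NP.1.2; [exact: Gx|exact: Gy].
Qed.

Lemma lspan_gen G : G `<=` lspan G.
Proof. by move=> x Gx N [_]; exact. Qed.

Lemma lspan_sub G N : lin_subspace N -> G `<=` N -> lspan G `<=` N.
Proof. by move=> Nl GN x; exact. Qed.

Lemma lin_subspaceD N x y : lin_subspace N -> N x -> N y -> N (x + y).
Proof. by move=> [_ Nl] Nx Ny; rewrite -[x]scale1r; exact: Nl. Qed.

Lemma lin_subspaceZ N a x : lin_subspace N -> N x -> N (a *: x).
Proof. by move=> [N0 Nl] Nx; rewrite -[_ *: _]addr0; exact: Nl. Qed.

Lemma lin_subspaceB N x y : lin_subspace N -> N x -> N y -> N (x - y).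
Proof.
by move=> Nl Nx Ny; apply: lin_subspaceD => //; rewrite -scaleN1r; exact: lin_subspaceZ.
Qed.

End Spans.

(** * Hilbert space geometry *)

Section InnerProduct.
Variables (R : realType) (V : hilbertType R).
Implicit Types (x y z : V) (a : R[i]).

Lemma innerC x y : inner x y = (inner y x)^*.
Proof. by rewrite hermC expr0 mul1r. Qed.

Lemma innerDl x y z : inner (x + y) z = inner x z + inner y z.
Proof. exact: linearDl. Qed.

Lemma innerDr x y z : inner z (x + y) = inner z x + inner z y.
Proof. exact: linearDr. Qed.

Lemma innerNl x z : inner (- x) z = - inner x z.
Proof. exact: linearNl. Qed.

Lemma innerNr x z : inner z (- x) = - inner z x.
Proof. exact: linearNr. Qed.

Lemma innerBl x y z : inner (x - y) z = inner x z - inner y z.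
Proof. by rewrite innerDl innerNl. Qed.

Lemma innerBr x y z : inner z (x - y) = inner z x - inner z y.
Proof. by rewrite innerDr innerNr. Qed.

Lemma inner0l z : inner 0 z = 0.
Proof. exact: linear0l. Qed.

Lemma inner0r z : inner z 0 = 0.
Proof. exact: linear0r. Qed.

Lemma innerZl a x z : inner (a *: x) z = a * inner x z.
Proof. exact: linearZl_LR. Qed.

Lemma innerZr a x z : inner z (a *: x) = a^* * inner z x.
Proof. exact: linearZr_LR. Qed.

Definition rip x y : R := complex.Re (inner x y).

Lemma ripC x y : rip x y = rip y x.
Proof. by rewrite /rip innerC RecJ. Qed.

Lemma ripDl x y z : rip (x + y) z = rip x z + rip y z.
Proof. by rewrite /rip innerDl RecD. Qed.

Lemma ripDr x y z : rip z (x + y) = rip z x + rip z y.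
Proof. by rewrite /rip innerDr RecD. Qed.

Lemma ripNl x z : rip (- x) z = - rip x z.
Proof. by rewrite /rip innerNl RecN. Qed.

Lemma ripNr x z : rip z (- x) = - rip z x.
Proof. by rewrite /rip innerNr RecN. Qed.

Lemma ripZl (r : R) x z : rip (r%:C%C *: x) z = r * rip x z.
Proof. by rewrite /rip innerZl RecZ. Qed.

Lemma ripZr (r : R) x z : rip z (r%:C%C *: x) = r * rip z x.
Proof. by rewrite ripC ripZl ripC. Qed.

Lemma inner_nrm x : inner x x = (nrm x ^+ 2)%:C%C.
Proof. by rewrite inner_normE nrmE -rmorphXn. Qed.

Lemma rip_nrm x : rip x x = nrm x ^+ 2.
Proof. by rewrite /rip inner_nrm. Qed.

Lemma rip_scale_diag (l : R[i]) x : rip (l *: x) x = complex.Re l * nrm x ^+ 2.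
Proof. by rewrite /rip innerZl inner_nrm mulrC RecZ mulrC. Qed.

Lemma nrm_sqrD x y : nrm (x + y) ^+ 2 = nrm x ^+ 2 + nrm y ^+ 2 + 2 * rip x y.
Proof. by rewrite -!rip_nrm !ripDl !ripDr (ripC y x); ring. Qed.

Lemma nrm_sqrB x y : nrm (x - y) ^+ 2 = nrm x ^+ 2 + nrm y ^+ 2 - 2 * rip x y.
Proof. by rewrite nrm_sqrD nrmN ripNr; ring. Qed.

Lemma rip_le x y : rip x y <= nrm x * nrm y.
Proof.
have [x0|x0] := eqVneq (nrm x) 0; first by rewrite (nrm_eq0 x0) /rip inner0l nrm0 mul0r.
have [y0|y0] := eqVneq (nrm y) 0; first by rewrite (nrm_eq0 y0) /rip inner0r nrm0 mulr0.
have xy : 0 < nrm x * nrm y by rewrite mulr_gt0 // lt_neqAle eq_sym ?x0 ?y0 nrm_ge0.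
(* Cauchy-Schwarz: expand the squared norm of [|y| x - |x| y] and divide by [|x| |y|]. *)
have := sqr_ge0 (nrm ((nrm y)%:C%C *: x - (nrm x)%:C%C *: y)).
rewrite nrm_sqrB !nrmZr ripZl ripZr !ger0_norm ?nrm_ge0 //.
move=> h; rewrite -(ler_pM2l xy); nra.
Qed.

Lemma cmod_inner_le x y : cmod (inner x y) <= nrm x * nrm y.
Proof.
set a := inner x y.
have [->|a0] := eqVneq a 0; first by rewrite /cmod normr0 mulr_ge0 ?nrm_ge0.
(* Rotating [x] by the conjugate of [a] makes the inner product the real number [|a|^2], which
   reduces the complex bound to the real one. *)
have := rip_le (a^* *: x) y.
rewrite /rip innerZl -/a nrmZ mulrC -normCK cmodE -rmorphXn /=.
have -> : cmod a^* = cmod a by rewrite /cmod norm_conjC.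
by rewrite expr2 -mulrA ler_pM2l // cmod_gt0.
Qed.

Lemma inner_eq0 x : (forall y, inner x y = 0) -> x = 0.
Proof.
move=> x0; apply: nrm_eq0; apply/eqP.
by rewrite -sqrf_eq0 -rip_nrm /rip x0.
Qed.

Lemma inner_inj x y : (forall z, inner z x = inner z y) -> x = y.
Proof.
move=> xy; apply/eqP; rewrite -subr_eq0; apply/eqP/inner_eq0 => z.
by rewrite innerC innerBr xy subrr rmorph0.
Qed.

Lemma orthogonal_projection (M : set V) (x : V) :
  lin_subspace M -> closed M ->
  exists2 p, M p & forall m, M m -> inner (x - p) m = 0.
Proof.
move=> [M0 Ml] Mc.
have MZ a m : M m -> M (a *: m) by move=> Mm; rewrite -[_ *: _]addr0; exact: Ml.
have MD m m' : M m -> M m' -> M (m + m').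
  by move=> Mm Mm'; rewrite -[m]scale1r; exact: Ml.
pose D := [set nrm (x - m) ^+ 2 | m in M].
have D0 : has_lbound D by exists 0 => _ [m _ <-]; exact: sqr_ge0.
have infD : has_inf D by split=> //; exists (nrm (x - 0) ^+ 2); exists 0.
pose d := inf D.
have dle m : M m -> d <= nrm (x - m) ^+ 2 by move=> Mm; apply: ge_inf => //; exists m.
have step (n : nat) : exists m, M m /\ nrm (x - m) ^+ 2 < d + n.+1%:R^-1.
  have n0 : 0 < (n.+1%:R^-1 : R) by rewrite invr_gt0.
  by have [_ [m Mm <-] mlt] := inf_adherent n0 infD; exists m.
have [u uP] := choice step.
(* Parallelogram law: the midpoint of [u n] and [u m] lies in [M], so its squared distance to [x] is
   at least [d]; hence the minimizing sequence is Cauchy. *)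
have par n m : nrm (u n - u m) ^+ 2 < 2 * n.+1%:R^-1 + 2 * m.+1%:R^-1.
  have [[Mn un] [Mm um]] := (uP n, uP m).
  have hD : M ((2^-1)%:C%C *: (u n + u m)) by apply: MZ; exact: MD.
  have := dle _ hD.
  have -> : x - (2^-1)%:C%C *: (u n + u m) = (2^-1)%:C%C *: ((x - u n) + (x - u m)).
    have {1}-> : x = (2^-1)%:C%C *: (x + x).
      rewrite -{2 3}[x]scale1r -scalerDl scalerA -(rmorph1 (real_complex R)).
      by rewrite -rmorphD -rmorphM /= mulVf ?rmorph1 ?scale1r // gt_eqF // addr_gt0.
    by rewrite -scalerBr opprD addrACA.
  rewrite nrmZr exprMn => h; rewrite nrm_sqrD in h.
  have -> : u n - u m = (x - u m) - (x - u n) by rewrite opprB [RHS]addrC subrKA.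
  rewrite nrm_sqrB (ripC (x - u m)).
  have h2 : `|2^-1 : R| ^+ 2 = 4^-1 by rewrite ger0_norm ?invr_ge0 //; field.
  rewrite h2 in h; move: un um h.
  move: (n.+1%:R^-1) (m.+1%:R^-1) => a b; lra.
have [|p pP] := @cauchy_nrm_cvg _ _ u.
  move=> e e0; have [|N NP] := @inv_nat_small _ (e ^+ 2 / 4); first by rewrite divr_gt0 ?exprn_gt0.
  exists N => n m Nn Nm; rewrite -ltr_sqr ?nnegrE ?nrm_ge0 ?ltW //.
  apply: lt_trans (par n m) _; move: (NP _ Nn) (NP _ Nm).
  move: (n.+1%:R^-1) (m.+1%:R^-1) => a b; lra.
have Mp : M p.
  apply: Mc; apply/closure_nrmP => e /pP[N NP].
  by exists (u N); [exact: (uP N).1|rewrite nrmB NP].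
exists p => // m Mm.
have pd : nrm (x - p) ^+ 2 <= d.
  have h (e : R) : 0 < e -> nrm (x - p) < Num.sqrt (d + e) + e.
    move=> e0; have [N NP] := pP e e0; have [N' NP'] := inv_nat_small e0.
    have [_ un] := uP (maxn N N').
    apply: le_lt_trans (nrmBD (u (maxn N N')) x p) _.
    apply: ltr_leD; last by apply/ltW/NP/leq_maxl.
    rewrite -ltr_sqr ?nnegrE ?nrm_ge0 ?sqrtr_ge0 //.
    move: un (NP' _ (leq_maxr N N')); move: (_.+1%:R^-1) => a un ne.
    rewrite sqr_sqrtr; first lra.
    have := sqr_ge0 (nrm (x - u (maxn N N'))); lra.
  have d0 : 0 <= d by apply: lb_le_inf => [|_ [m' _ <-]]; [exact: infD.1|exact: sqr_ge0].
  rewrite leNgt; apply/negP => dlt.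
  set n0 := nrm (x - p) in h dlt *.
  have n00 : 0 < n0.
    rewrite lt_neqAle nrm_ge0 andbT; apply: contraTneq dlt => <-.
    by rewrite expr0n /= -leNgt.
  pose s := n0 ^+ 2 - d.
  have s0 : 0 < s by rewrite subr_gt0.
  (* With this [e] one has [(n0 - e)^2 = d + 2 e + e^2], which exceeds the bound [d + e] given by
     [h]. *)
  pose e := s / (2 * (n0 + 1)).
  have e0 : 0 < e by rewrite divr_gt0 // mulr_gt0 // addr_gt0.
  have eE : e * (2 * (n0 + 1)) = s by rewrite divfK // mulf_neq0 // gt_eqF // addr_gt0.
  have en : e < n0.
    rewrite ltr_pdivrMr ?mulr_gt0 ?addr_gt0 // /s; nra.
  have := h e e0; rewrite -ltrBlDr -ltr_sqr ?nnegrE ?sqrtr_ge0 ?subr_ge0 ?ltW //.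
  rewrite sqr_sqrtr ?addr_ge0 ?(ltW e0) //.
  rewrite /s in eE; nra.
set a := inner (x - p) m.
have [//|a0] := eqVneq a 0.
(* Moving [p] by [s a m] changes the squared distance by [- s |a|^2 (1 + s)], because
   [s |m|^2 = 1 - s]; a nonzero [a] would thus contradict minimality. The summand 1 keeps the
   denominator positive when [m = 0]. *)
pose s : R := (nrm m ^+ 2 + 1)^-1.
have m1 : 0 < nrm m ^+ 2 + 1 by rewrite ltr_wpDl ?sqr_ge0.
have s0 : 0 < s by rewrite invr_gt0.
have : d <= nrm (x - (p + (s%:C%C * a) *: m)) ^+ 2.
  by apply/dle/MD => //; exact: MZ.
rewrite opprD addrA nrm_sqrB nrmZ -scalerA ripZr /rip innerZr -/a.
have -> : complex.Re (a^* * a) = cmod a ^+ 2 by rewrite mulrC -normCK cmodE -rmorphXn.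
have -> : cmod (s%:C%C * a) = s * cmod a.
  by rewrite /cmod normrM ger0_norm ?lecR ?ltW // RecZ.
have sm : s * (nrm m ^+ 2 + 1) = 1 by rewrite mulVf // gt_eqF.
have ca := cmod_gt0 a0.
have : 0 < s * cmod a ^+ 2 by rewrite mulr_gt0 ?exprn_gt0.
rewrite exprMn; set A := cmod a ^+ 2; set B := nrm m ^+ 2 in sm *.
rewrite exprMn.
have -> : s ^+ 2 * A * B = s * A * (s * B) by ring.
have -> : s * B = 1 - s by rewrite -sm; ring.
move=> sA dl; exfalso; move: sA dl pd s0; clear; move: (s * A) => q; nra.
Qed.

Lemma dense_orthogonal (M : set V) : lin_subspace M ->
  (forall w, (forall m, M m -> inner w m = 0) -> w = 0) -> dense M.
Proof.
move=> Ml M0; apply/dense_nrmP => x.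
have [p cp px] := orthogonal_projection x (lin_subspace_closure Ml) (@closed_closure _ M).
have /eqP : x - p = 0 by apply: M0 => m Mm; apply/px/subset_closure.
by rewrite subr_eq0 => /eqP ->; exact/closure_nrmP.
Qed.

Lemma dense_orthogonal_eq0 (M : set V) (w : V) : dense M ->
  (forall m, M m -> inner w m = 0) -> w = 0.
Proof.
move=> /dense_nrmP dM wM; apply: nrm_small => e e0; have [m Mm wm] := dM w e e0.
apply: le_lt_trans wm; have := rip_le (w - m) w.
rewrite {1}/rip innerBl (innerC m) (wM m) // rmorph0 subr0 -/(rip _ _) rip_nrm.
have := nrm_ge0 w; rewrite le_eqVlt => /orP[/eqP <- _|w0]; first exact: nrm_ge0.
by rewrite expr2 ler_pM2r.
Qed.

Lemma dense_orthogonalP (M : set V) : lin_subspace M ->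
  dense M <-> forall w, (forall m, M m -> inner w m = 0) -> w = 0.
Proof.
move=> Ml; split=> [dM w|]; first exact: dense_orthogonal_eq0.
exact: dense_orthogonal.
Qed.

Lemma riesz_representation (f : V -> R[i]) (C : R) :
  (forall a x y, f (a *: x + y) = a * f x + f y) ->
  (forall x, cmod (f x) <= C * nrm x) ->
  exists v, forall x, f x = inner x v.
Proof.
move=> fl fC.
have fD x y : f (x + y) = f x + f y by rewrite -[x in LHS]scale1r fl mul1r.
have f0 : f 0 = 0 by apply: (addrI (f 0)); rewrite -fD !addr0.
have fZ a x : f (a *: x) = a * f x by rewrite -[_ *: _]addr0 fl f0 addr0.
have fB x y : f (x - y) = f x - f y by rewrite fD -scaleN1r fZ mulN1r.
have [[x0 fx0]|Nf] := pselect (exists x, f x != 0); last first.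
  exists 0 => x; rewrite inner0r; apply/eqP; apply: contrapT => /negP fx.
  by apply: Nf; exists x.
have Kl : lin_subspace [set x | f x = 0].
  by split=> // a x y /= fx fy; rewrite fl fx fy mulr0 addr0.
have Kc : closed [set x | f x = 0] by exact: (closed_kernel fB fC).
have [p /= fp pK] := orthogonal_projection x0 Kl Kc.
pose e := x0 - p; have fe : f e != 0 by rewrite fB fp subr0.
have ee : inner e e != 0.
  rewrite inner_nrm; apply: contraNneq fe => /(congr1 (@complex.Re R)) /= /eqP.
  by rewrite sqrf_eq0 => /eqP/nrm_eq0 ->; rewrite f0.
(* [e] spans the orthogonal complement of the kernel; the scalar is fixed by the value at [e],
   conjugated because it sits in the second slot. *)
exists ((f e / inner e e)^* *: e) => x.
have h : f (x - (f x / f e) *: e) = 0 by rewrite fB fZ divfK // subrr.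
have /pK : [set x | f x = 0] (x - (f x / f e) *: e) by [].
rewrite -/e innerC => /eqP; rewrite conjC_eq0 innerBl innerZl subr_eq0 => /eqP xe.
by rewrite innerZr conjcc xe; field; rewrite ee fe.
Qed.
End InnerProduct.

Section Adjoint.
Variables (R : realType) (V W : hilbertType R).

Lemma adjointE (E : V -> W) (w : W) (v : V) :
  (forall x, inner (E x) w = inner x v) -> adjoint E w = v.
Proof.
move=> vP; apply: inner_inj => x; rewrite -vP.
have : [set v | forall x, inner (E x) w = inner x v] (adjoint E w).
  by rewrite /adjoint; case: xgetP => [_ -> //|/(_ v)]; case.
by move=> /(_ x) <-.
Qed.

Lemma adjointP (E : V -> W) :
  (forall a x y, E (a *: x + y) = a *: E x + E y) -> contractive E ->
  forall x w, inner (E x) w = inner x (adjoint E w).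
Proof.
move=> El /contractive_nrm EC x w.
have [|y|v vP] := @riesz_representation _ V (fun x => inner (E x) w) (nrm w).
- by move=> a y z; rewrite El innerDl innerZl.
- apply: le_trans (cmod_inner_le _ _) _; rewrite mulrC.
  by rewrite ler_wpM2l ?nrm_ge0.
- by rewrite (adjointE vP).
Qed.

End Adjoint.

(** * The indefinite form of an energy balance *)

Section Nodes.
Variables (R : realType) (U X Y : hilbertType R).
Implicit Types (S : set ((X * U) * (X * Y))) (p q : (X * U) * (X * Y)).

Definition kform p q : R[i] :=
  inner p.2.1 q.1.1 + inner p.1.1 q.2.1 - inner p.1.2 q.1.2 + inner p.2.2 q.2.2.

Lemma kformC p q : kform p q = (kform q p)^*.
Proof.
rewrite /kform !rmorphD rmorphN /= -!innerC.
by congr (_ - _ + _); exact: addrC.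
Qed.

Lemma kform_Pl a p p' q : kform (a *: p + p') q = a * kform p q + kform p' q.
Proof. by rewrite /kform /= !innerDl !innerZl; ring. Qed.

Lemma kform_Pr a p q q' : kform p (a *: q + q') = a^* * kform p q + kform p q'.
Proof. by rewrite /kform /= !innerDr !innerZr; ring. Qed.

Lemma kform_diag x u z y :
  kform ((x, u), (z, y)) ((x, u), (z, y)) =
  (2 * rip z x - nrm u ^+ 2 + nrm y ^+ 2)%:C%C.
Proof.
rewrite /kform /= !inner_nrm (innerC x z) rmorphD rmorphB /=.
congr (_ - _ + _); rewrite rmorphM /= rmorph_nat.
exact: addcJ.
Qed.

Lemma energy_preservingE S : energy_preserving S <->
  forall x u z y, S ((x, u), (z, y)) -> 2 * rip z x = nrm u ^+ 2 - nrm y ^+ 2.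
Proof.
have key (x : X) (u : U) (z : X) (y : Y) : (2 * 'Re (inner z x) = `|u| ^+ 2 - `|y| ^+ 2) <->
    2 * rip z x = nrm u ^+ 2 - nrm y ^+ 2.
  have -> : (2 : R[i]) = (2 : R)%:C%C by rewrite rmorph_nat.
  rewrite -complexRe !nrmE -!rmorphXn -rmorphM -rmorphB /=.
  by split=> [/complexI|->].
by split=> h x u z y /h /key.
Qed.

Lemma passiveE S : passive S <->
  forall x u z y, S ((x, u), (z, y)) -> 2 * rip z x <= nrm u ^+ 2 - nrm y ^+ 2.
Proof.
have key (x : X) (u : U) (z : X) (y : Y) : (2 * 'Re (inner z x) <= `|u| ^+ 2 - `|y| ^+ 2) <->
    2 * rip z x <= nrm u ^+ 2 - nrm y ^+ 2.
  have -> : (2 : R[i]) = (2 : R)%:C%C by rewrite rmorph_nat.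
  by rewrite -complexRe !nrmE -!rmorphXn -rmorphM -rmorphB /= lecR.
by split=> h x u z y /h /key.
Qed.

(** Polarization: the quadratic form vanishes at [a *: p + q], and the choices [a = 1] and [a = i]
    annihilate the real and the imaginary part of [kform p q]. *)
Lemma energy_kform S : lin_subspace S ->
  (energy_preserving S <-> forall p q, S p -> S q -> kform p q = 0).
Proof.
move=> Sl; rewrite energy_preservingE; split=> [h p q Sp Sq|h x u z y Sp]; last first.
  by have := h _ _ Sp Sp; rewrite kform_diag => /(congr1 (@complex.Re R)) /=; lra.
have diag r : S r -> kform r r = 0.
  case: r => [[x u] [z y]] /h E; rewrite kform_diag (_ : _ + _ = 0) //; lra.
have E a : a * kform p q + a^* * (kform p q)^* = 0.
  have := diag _ (Sl.2 a p q Sp Sq).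
  by rewrite kform_Pl !kform_Pr !diag // -(kformC q p) mulr0 add0r addr0.
have := E 1; have := E 'i%C; case: (kform p q) => r s.
move=> /eqP; rewrite eq_complex /= => /andP[/eqP e1 _].
move=> /eqP; rewrite eq_complex /= => /andP[/eqP e2 _].
by congr Complex; lra.
Qed.

Lemma closed_kform q : closed [set p | kform p q = 0].
Proof.
apply: (@closed_kernel _ _ _ (nrm q.1.1 + nrm q.2.1 + nrm q.1.2 + nrm q.2.2)).
  by move=> x y; rewrite -scaleN1r addrC kform_Pl mulN1r addrC.
move=> [[x u] [z y]]; rewrite /kform /=.
have tri (a b : R[i]) : cmod (a + b) <= cmod a + cmod b.
  by rewrite -RecD; apply/le_Rec/ler_normD.
have cN (a : R[i]) : cmod (- a) = cmod a by rewrite /cmod normrN.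
set P := nrm (_, _).
have hx : nrm x <= P by apply: le_trans (nrm_pairl _ u) (nrm_pairl _ _).
have hu : nrm u <= P by apply: le_trans (nrm_pairr x u) (nrm_pairl _ _).
have hz : nrm z <= P by apply: le_trans (nrm_pairl z y) (nrm_pairr _ _).
have hy : nrm y <= P by apply: le_trans (nrm_pairr z y) (nrm_pairr _ _).
apply: le_trans (tri _ _) _; apply: le_trans (lerD (tri _ _) (lexx _)) _.
apply: le_trans (lerD (lerD (tri _ _) (lexx _)) (lexx _)) _; rewrite cN.
have := cmod_inner_le z q.1.1; have := cmod_inner_le x q.2.1.
have := cmod_inner_le u q.1.2; have := cmod_inner_le y q.2.2.
have := nrm_ge0 q.1.1; have := nrm_ge0 q.2.1.
have := nrm_ge0 q.1.2; have := nrm_ge0 q.2.2.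
move: (nrm q.1.1) (nrm q.2.1) (nrm q.1.2) (nrm q.2.2) => a b c d.
move: (cmod (inner z _)) (cmod (inner x _)) (cmod (inner u _)) (cmod (inner y _)) => a' b' c' d'.
move: (nrm x) (nrm u) (nrm z) (nrm y) hx hu hz hy => ????.
move=> hx hu hz hy d0 c0 b0 a0 h1 h2 h3 h4.
rewrite !mulrDl -!addrA.
apply: lerD; first by apply: le_trans h4 _; rewrite mulrC ler_wpM2l.
apply: lerD; first by apply: le_trans h3 _; rewrite mulrC ler_wpM2l.
apply: lerD; first by apply: le_trans h2 _; rewrite mulrC ler_wpM2l.
by apply: le_trans h1 _; rewrite mulrC ler_wpM2l.
Qed.

(** Vanishing passes from the generators to the closed span in one argument at a time, [kformC]
    exchanging the two. *)
Lemma kform_closure_span (G : set ((X * U) * (X * Y))) :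
  (forall p q, G p -> G q -> kform p q = 0) ->
  forall p q, closure (lspan G) p -> closure (lspan G) q -> kform p q = 0.
Proof.
move=> G0.
have ext q : (forall p, G p -> kform p q = 0) ->
    forall p, closure (lspan G) p -> kform p q = 0.
  move=> Gq; apply: closure_sub; first exact: closed_kform.
  apply: lspan_sub => //; split=> [|a p p' /= pq p'q].
    by rewrite /= /kform /= !inner0l subr0 !addr0.
  by rewrite kform_Pl pq p'q mulr0 addr0.
move=> p q Gp Gq; apply: (ext _ _ _ Gp) => p' Gp'.
rewrite kformC; apply/eqP; rewrite conjC_eq0; apply/eqP.
by apply: (ext _ _ _ Gq) => q' Gq'; exact: G0.
Qed.

End Nodes.

(** * Maximal passive relations and their adjoints *)

Section PassiveRelations.
Variables (R : realType) (U X Y : hilbertType R).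
Implicit Types (S V : set ((X * U) * (X * Y))).

(** The energy inequality reads [2 Re l |x|^2 <= - |y|^2] here. *)
Lemma passive_eq0 S l x y : passive S -> Cplus l ->
  S ((x, 0), (l *: x, y)) -> x = 0 /\ y = 0.
Proof.
move=> /passiveE Sp /CplusE l0 /Sp; rewrite rip_scale_diag nrm0 expr0n /= sub0r => h.
have x0 := sqr_ge0 (nrm x); have y0 := sqr_ge0 (nrm y).
have xx : nrm x ^+ 2 = 0 by nra.
have yy : nrm y ^+ 2 = 0 by rewrite xx in h; nra.
by split; apply: nrm_eq0; apply/eqP; rewrite -sqrf_eq0 ?xx ?yy.
Qed.

(* Maximality of a passive relation: the Cayley transform at the point 1 is
   everywhere defined. *)
Definition node_range S : Prop :=
  forall w u, exists x z y, S ((x, u), (z, y)) /\ x - z = w.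

(** At zero input, passivity gives [|x|^2 + |z|^2 + |y|^2 <= |x - z|^2], so the graph norm is at
    most [3 |x - z|] and [closed_range] upgrades density to surjectivity. A general input is handled
    by subtracting any graph element that carries it. *)
Lemma node_range_of_dense S :
  lin_subspace S -> closed S -> passive S ->
  (forall u, exists x z y, S ((x, u), (z, y))) ->
  dense [set w | exists x z y, S ((x, 0), (z, y)) /\ x - z = w] ->
  node_range S.
Proof.
move=> Sl Sc /passiveE Sp Su Sd.
pose M := [set p | S p /\ p.1.2 = 0].
pose T (p : (X * U) * (X * Y)) := p.1.1 - p.2.1.
have Ml : lin_subspace M.
  split; first by split; [exact: Sl.1|].
  move=> a p q [Sp' p0] [Sq q0]; split; first exact: Sl.2.
  by rewrite /= p0 q0 scaler0 addr0.
have Mc : closed M.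
  apply: closed_nrmP => p pM; split.
    apply: Sc; apply/closure_nrmP => e /pM[q [Sq _] pq]; by exists q.
  apply: nrm_small => e /pM[q [_ q0]]; apply: le_lt_trans.
  have -> : p.1.2 = (p - q).1.2 by rewrite -[LHS]subr0 -q0.
  by apply: le_trans (nrm_snd _) _; exact: nrm_fst.
have surj0 w : exists x z y, S ((x, 0), (z, y)) /\ x - z = w.
  have : (T @` M) w.
    apply: (@closed_range _ _ _ M T 3 2) => //.
    - by do !apply: nrm_complete_pair; exact: cauchy_nrm_cvg.
    - move=> p q; rewrite /T.
      have -> : (p - q).1.1 = p.1.1 - q.1.1 by [].
      have -> : (p - q).2.1 = p.2.1 - q.2.1 by [].
      by rewrite opprD addrACA -opprD.
    - move=> [[x u] [z y]]; rewrite /T /=; set P := nrm (_, _).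
      have hx : nrm x <= P by apply: le_trans (nrm_pairl _ u) (nrm_pairl _ _).
      have hz : nrm z <= P by apply: le_trans (nrm_pairl z y) (nrm_pairr _ _).
      by have := nrmD x (- z); rewrite nrmN; lra.
    - move=> [[x u] [z y]] [/Sp + /= u0]; rewrite {}u0 nrm0 expr0n /= sub0r => h.
      rewrite /T /=; have := nrm_sqrB x z; rewrite (ripC x) => E.
      have le_of (v : R) : 0 <= v -> v ^+ 2 <= nrm (x - z) ^+ 2 -> v <= nrm (x - z).
        by move=> v0; rewrite ler_sqr ?nnegrE ?nrm_ge0.
      have x0 := sqr_ge0 (nrm x); have y0 := sqr_ge0 (nrm y); have z0 := sqr_ge0 (nrm z).
      have h1 : nrm x <= nrm (x - z) by apply: le_of; rewrite ?nrm_ge0 // E; lra.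
      have h2 : nrm z <= nrm (x - z) by apply: le_of; rewrite ?nrm_ge0 // E; lra.
      have h3 : nrm y <= nrm (x - z) by apply: le_of; rewrite ?nrm_ge0 // E; lra.
      have := nrm_pair (x, 0 : U) (z, y); have := nrm_pair x (0 : U).
      by have := nrm_pair z y; rewrite nrm0; lra.
    - apply/closure_nrmP => e e0.
      have /dense_nrmP/(_ w e e0)[_ [x [z [y [Sxz <-]]]] wxz] := Sd.
      by exists (x - z) => //; exists ((x, 0), (z, y)).
  by move=> [[[x u] [z y]] [Sxz /= u0] <-]; rewrite u0 in Sxz; exists x, z, y.
move=> w u; have [x [z [y Sxz]]] := Su u.
have [x' [z' [y' [Sxz' E]]]] := surj0 (w - (x - z)).
exists (x + x'), (z + z'), (y + y'); split.
  have h : S ((x + x', u + 0), (z + z', y + y')) := lin_subspaceD Sl Sxz Sxz'.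
  by rewrite addr0 in h.
by rewrite opprD addrACA E addrC subrK.
Qed.

(** Each element of [S] has a companion in [V] with the same input and the same [x - z]. Their
    difference has zero input and equal state and derivative, so [passive_eq0] at the point 1 kills
    it. *)
Lemma node_range_max S V :
  lin_subspace S -> passive S -> V `<=` S -> node_range V -> S `<=` V.
Proof.
move=> Sl Sp VS Vr [[x u] [z y]] Sxz.
have [x' [z' [y' [Vxz' E]]]] := Vr (x - z) u.
have h : S ((x - x', u - u), (z - z', y - y')) := lin_subspaceB Sl Sxz (VS _ Vxz').
have zx : z - z' = 1 *: (x - x').
  by rewrite scale1r; apply/eqP; rewrite eq_sym -subr_eq0 opprD addrACA -opprD E subrr.
rewrite zx subrr in h.
have [x0 y0] := passive_eq0 Sp (@Cplus1 R) h.
have -> : x = x' by apply/eqP; rewrite -subr_eq0 x0.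
have -> : z = z' by apply/eqP; rewrite -subr_eq0 zx x0 scaler0.
by have -> : y = y' by apply/eqP; rewrite -subr_eq0 y0.
Qed.

(** With input and output weighted by the square root of 2, the Cayley transform [K] of [S] is a
    contraction, and its adjoint sends [(q - r, g)] to [(q + r, d)]. Choosing [x - z = q + r] with
    input [d] evaluates [K] at the image of [v = (q - r, g)] under the adjoint; the two squares are
    the components of [v] minus that value. *)
Lemma passive_adjoint S : passive S -> node_range S -> passive (node_adjoint S).
Proof.
move=> /passiveE Sp Sr; apply/passiveE => q g r d qP.
have [x [z [y [Sxz E]]]] := Sr (q + r) d.
have /(congr1 (@complex.Re R)) := qP _ Sxz.
rewrite /= !RecD -!/(rip _ _) rip_nrm => E1.
have := Sp _ _ _ _ Sxz.
have := sqr_ge0 (nrm (q - r - (x + z))).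
have := sqr_ge0 (nrm (y - g)).
have := nrm_sqrB x z; rewrite {1}E.
have := rip_nrm (q + r); rewrite -{1}E.
rewrite (nrm_sqrB (q - r)) (nrm_sqrB q r) (nrm_sqrD q r) (nrm_sqrD x z) (nrm_sqrB y).
rewrite !(ripDl, ripDr, ripNl, ripNr) (ripC q z) (ripC r z) (ripC x z) (ripC q x).
rewrite (ripC r x) (ripC q r); lra.
Qed.

End PassiveRelations.

(** * Resolvents of dissipative semigroup generators *)

Section Semigroup.
Variables (R : realType) (X : hilbertType R) (T : R -> {linear X -> X}).
Hypothesis T_C0 : C0_semigroup T.
Let A := sg_generator T.

Lemma near_right0 (P : R -> Prop) : (\forall t \near 0^'+, P t) ->
  exists2 d : R, 0 < d & forall t, 0 < t -> t < d -> P t.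
Proof.
move=> [d /= d0 dP]; exists d => // t t0 td; apply: dP => //=.
by rewrite sub0r normrN gtr0_norm.
Qed.

Lemma semigroup_cvg0 x (e : R) : 0 < e ->
  exists2 d : R, 0 < d & forall t, 0 < t -> t < d -> nrm (x - T t x) < e.
Proof.
have [_ _ _ /(_ x)/nrm_cvgP Tx] := T_C0.
by move=> /Tx/near_right0.
Qed.

Lemma semigroup_generator_diff x z (e : R) : A (x, z) -> 0 < e ->
  exists2 d : R, 0 < d & forall h, 0 < h -> h < d ->
    nrm (T h x - x - h%:C%C *: z) <= e * h.
Proof.
move=> /nrm_cvgP Axz /Axz/near_right0[d d0 dP]; exists d => // h h0 hd.
have -> : T h x - x - h%:C%C *: z =
    h%:C%C *: ((h^-1)%:C%C *: (T h x - x) - z).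
  rewrite scalerBr scalerA -rmorphM /= mulfV ?gt_eqF //.
  by rewrite rmorph1 scale1r.
rewrite nrmZr gtr0_norm // mulrC ler_pM2r // nrmB.
exact/ltW/dP.
Qed.

Lemma generator_lin : lin_subspace A.
Proof.
split=> [|a [x z] [x' z'] /= Axz Axz'].
  by rewrite /A /sg_generator /=; under eq_fun do rewrite linear0 subrr scaler0; exact: cvg_cst.
rewrite /A /sg_generator /=.
have -> : (fun h : R => (h^-1)%:C%C *: (T h (a *: x + x') - (a *: x + x'))) =
    (fun h : R => a *: ((h^-1)%:C%C *: (T h x - x)) + (h^-1)%:C%C *: (T h x' - x')).
  apply/funext => h; rewrite linearP opprD addrACA -scalerBr scalerDr.
  by rewrite !scalerA (mulrC a).
by apply: cvgD => //; exact: cvgZr.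
Qed.

Lemma semigroup_generator_shift t x z : 0 <= t -> A (x, z) -> A (T t x, T t z).
Proof.
have [Tc T0 Ta _] := T_C0.
move=> t0 /nrm_cvgP Axz; apply/nrm_cvgP => /= e e0.
have /continuous_nrmP/(_ z e e0)[d d0 dP] := Tc t t0.
near=> h.
have h0 : 0 < h by near: h; exact: nbhs_right_gt.
have -> : T h (T t x) - T t x = T t (T h x - x).
  by rewrite linearB /= -(Ta t h) ?(ltW h0) // -(Ta h t) ?(ltW h0) // (addrC t).
rewrite -linearZ /=; apply: dP.
by near: h; exact: (Axz d d0).
Unshelve. all: by end_near. Qed.

(** Domain vectors near [x] come from the resolvent instead of orbit averages: the difference
    quotient of [T] at [Q x] tends to [b *: Q x - x], and it lies in the domain because [Q x] and
    its orbit do. *)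
Lemma generator_dense b : resolvent_set A b -> dense [set x | exists z, A (x, z)].
Proof.
move=> [Q [_ AQ _]]; apply/dense_nrmP => x e e0.
have /nrm_cvgP/(_ e e0)/near_right0[d d0 dP] := AQ x.
pose h := d / 2; have h0 : 0 < h by rewrite divr_gt0.
have hd : h < d by rewrite /h; lra.
have := dP h h0 hd; rewrite /=; set y := (_%:C)%C *: _ => ye.
exists (b *: Q x - y); last by rewrite nrmB; move: ye; rewrite addrAC.
exists (b *: (b *: Q x - x) -
  (h^-1)%:C%C *: (T h (b *: Q x - x) - (b *: Q x - x))).
have Al := generator_lin.
have h1 := lin_subspaceZ b Al (AQ x).
have h2 := lin_subspaceB Al (semigroup_generator_shift (ltW h0) (AQ x)) (AQ x).
exact: (lin_subspaceB Al h1 (lin_subspaceZ (h^-1)%:C%C Al h2)).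
Qed.

(* The Banach-Steinhaus theorem for [T], by nested balls. *)
Lemma semigroup_locally_bounded :
  exists2 d : R, 0 < d & exists M : R, forall t, 0 <= t -> t <= d ->
    forall x, nrm (T t x) <= M * nrm x.
Proof.
have [Tc T0 _ _] := T_C0.
apply: contrapT => unb.
have large (d M : R) : 0 < d ->
    exists t v, [/\ 0 <= t, t <= d & M * nrm v < nrm (T t v)].
  move=> d0; apply: contrapT => H; apply: unb; exists d => //; exists M => t t0 td x.
  by rewrite leNgt; apply/negP => Mx; apply: H; exists t, x.
have step (a : nat * (X * R)) : exists b : R * (X * R), 0 < a.2.2 ->
    [/\ 0 <= b.1, b.1 <= a.1.+1%:R^-1, 0 < b.2.2, b.2.2 <= a.1.+1%:R^-1 &
    forall y, nrm (y - b.2.1) <= b.2.2 ->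
      nrm (y - a.2.1) <= a.2.2 /\ a.1%:R <= nrm (T b.1 y)].
  (* For a nonpositive radius the required property is vacuous and any value will do; this makes the
     step total, as [choice] demands. *)
  case: a => n [x r] /=; have [r0|] := ltP 0 r; last by exists (0, (0, 0)).
  have n0 : 0 < (n.+1%:R^-1 : R) by rewrite invr_gt0.
  (* The factor is chosen so that [v], rescaled to norm [r / 2], has an image of norm above
     [2 (n + 1)]. *)
  have [t [v [t0 tn tv]]] := large n.+1%:R^-1 (4 * n.+1%:R / r) n0.
  have v0 : 0 < nrm v.
    rewrite lt_neqAle nrm_ge0 andbT eq_sym; apply: contraTneq tv => /nrm_eq0 ->.
    by rewrite linear0 nrm0 mulr0 ltxx.
  pose v' := (r / 2 / nrm v)%:C%C *: v.
  have c0 : 0 < r / 2 / nrm v by rewrite !divr_gt0.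
  have nv' : nrm v' = r / 2 by rewrite nrmZr gtr0_norm // divfK ?gt_eqF.
  have Tv' : 2 * n.+1%:R < nrm (T t v').
    rewrite linearZ /= nrmZr gtr0_norm //.
    rewrite -(ltr_pM2l c0) in tv; apply: le_lt_trans tv.
    rewrite le_eqVlt; apply/orP; left; apply/eqP.
    by field; rewrite !gt_eqF.
  (* The images of [x + v'] and [x - v'] differ by twice the image of [v'], so one of them has norm
     above [n + 1]. *)
  have [x' [xx' Tx']] : exists x', nrm (x' - x) <= r / 2 /\ n.+1%:R < nrm (T t x').
    have tri : 2 * nrm (T t v') <= nrm (T t (x + v')) + nrm (T t (x - v')).
      have -> : 2 * nrm (T t v') = nrm (T t (x + v') - T t (x - v')).
        rewrite -linearB /= opprD opprK addrACA subrr add0r linearD /=.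
        by rewrite nrm_double.
      by have := nrmD (T t (x + v')) (- T t (x - v')); rewrite nrmN.
    have [h|h] := ltP n.+1%:R (nrm (T t (x + v'))).
      by exists (x + v'); rewrite addrC addKr nv' lexx.
    exists (x - v'); rewrite addrC addKr nrmN nv' lexx; split=> //.
    have : 0 < (n.+1%:R : R) by rewrite ltr0n.
    by move: (n.+1%:R : R) Tv' h => N; lra.
  have /continuous_nrmP/(_ x' 1 ltr01)[d d0 dP] := Tc t t0.
  (* [r / 2] nests the balls, [d / 2] keeps images within 1 of the image of [x'] and hence above
     [n], and the last term makes the radii tend to 0. *)
  pose r' := Num.min (r / 2) (Num.min (d / 2) n.+1%:R^-1).
  exists (t, (x', r')) => _ /=; split=> //.
  - by rewrite !lt_min n0 !divr_gt0.
  - by rewrite !ge_min lexx !orbT.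
  move=> y; rewrite !le_min => /and3P[y1 y2 _]; split.
    by apply: le_trans (nrmBD x' _ _) _; lra.
  have /dP : nrm (x' - y) < d by rewrite nrmB; lra.
  move: Tx'; rewrite -natr1 => Tx'; have := nrm_lipschitz (T t x') (T t y); lra.
have [f fP] := choice step.
pose fix a n := if n is p.+1 then (f (p, a p)).2 else (0 : X, 1 : R).
have a0 n : 0 < (a n).2.
  by elim: n => [|n IH] /=; [exact: ltr01|have [] := fP (n, a n) IH].
have nest n m : (n <= m)%N ->
    forall y, nrm (y - (a m).1) <= (a m).2 -> nrm (y - (a n).1) <= (a n).2.
  elim: m => [|m IH]; first by rewrite leqn0 => /eqP ->.
  rewrite leq_eqVlt => /orP[/eqP -> //|/IH h] y ym.
  by apply: h; have [_ _ _ _ /(_ y ym)[]] := fP (m, a m) (a0 m).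
have an n m : (n <= m)%N -> nrm ((a m).1 - (a n).1) <= (a n).2.
  by move=> nm; apply: (nest _ _ nm); rewrite subrr nrm0 ltW.
have [|l lP] := @cauchy_nrm_cvg _ _ (fun n => (a n).1).
  move=> e e0; have [|N NP] := @inv_nat_small R (e / 2); first by rewrite divr_gt0.
  have rN : (a N.+1).2 < e / 2.
    by apply: le_lt_trans (NP N (leqnn N)); have [] := fP (N, a N) (a0 N).
  exists N.+1 => n m Nn Nm; apply: le_lt_trans (nrmBD (a N.+1).1 _ _) _.
  have := an _ _ Nn; have := an _ _ Nm; rewrite (nrmB (a N.+1).1); lra.
have la n : nrm (l - (a n).1) <= (a n).2.
  rewrite leNgt; apply/negP => h.
  have [|N NP] := lP (nrm (l - (a n).1) - (a n).2); first by rewrite subr_gt0.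
  have := NP _ (leq_maxl N n); have := an _ _ (leq_maxr N n).
  have := nrmBD (a (maxn N n)).1 l (a n).1; rewrite (nrmB l (a (maxn N n)).1); lra.
(* The selected times tend to 0, where strong continuity bounds the orbit of [l] by [nrm l + 1]; but
   [l] lies in every ball, so the [n]-th time gives a norm of at least [n]. *)
have [d d0 dP] := semigroup_cvg0 l ltr01.
have [N NP] := inv_nat_small d0.
pose n := maxn N (Num.truncn (nrm l + 1)).+1.
have [t0 tn _ _ /(_ l (la n.+1))[_ /= Tl]] := fP (n, a n) (a0 n).
have big : nrm l + 1 < n%:R.
  by apply: lt_le_trans (truncnS_gt _) _; rewrite ler_nat leq_maxr.
have td := le_lt_trans tn (NP n (leq_maxl _ _)).
have : nrm (T (f (n, a n)).1 l) <= nrm l + 1.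
  move: t0; rewrite le_eqVlt => /orP[/eqP <-|t0]; first by rewrite T0 lerDl.
  apply: le_trans (nrm_lipschitz _ l) _; rewrite lerD2l nrmB ltW //.
  exact: dP.
by move: Tl big => /=; lra.
Qed.

Hypothesis A_dissipative : forall x z, A (x, z) -> rip z x <= 0.

Lemma dissipative_le (h : R) (x z : X) : 0 < h -> rip z x <= 0 ->
  nrm x <= nrm (x - h%:C%C *: z).
Proof.
move=> h0 zx; rewrite -ler_sqr ?nnegrE ?nrm_ge0 // nrm_sqrB ripZr (ripC x).
have := sqr_ge0 (nrm (h%:C%C *: z)); nra.
Qed.

(* An implicit Euler step does not increase the norm; the local bound on [T]
   makes the sum of the discretisation errors small. *)
Lemma semigroup_contraction_dom : exists2 d : R, 0 < d &
  forall t x z, 0 < t -> t <= d -> A (x, z) -> nrm (T t x) <= nrm x.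
Proof.
have [Tc T0 Ta _] := T_C0.
have [d d0 [M MP]] := semigroup_locally_bounded.
exists d => // t x z t0 td Axz.
have M0 : 0 <= `|M| by [].
have ME s : 0 <= s -> s <= d -> forall y, nrm (T s y) <= `|M| * nrm y.
  move=> s0 sd y; apply: le_trans (MP s s0 sd y) _.
  by rewrite ler_wpM2r ?nrm_ge0 ?ler_norm.
have key (e : R) : 0 < e -> nrm (T t x) <= nrm x + 2 * `|M| * e * t.
  move=> e0.
  have [d1 d10 d1P] := semigroup_generator_diff Axz e0.
  have [d2 d20 d2P] := semigroup_cvg0 z e0.
  have m0 : 0 < Num.min d1 d2 / t by rewrite divr_gt0 // lt_min d10.
  have [n nP] := inv_nat_small m0.
  (* [n + 1] steps of this length end exactly at [t], and each is short enough for both error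
     estimates. *)
  pose h := t * n.+1%:R^-1.
  have h0 : 0 < h by rewrite mulr_gt0 // invr_gt0.
  have hmin : h < Num.min d1 d2 by rewrite /h mulrC -ltr_pdivlMr // nP.
  move: hmin; rewrite lt_min => /andP[hd1 hd2].
  have hn : n.+1%:R * h = t by rewrite /h mulrCA mulfV ?mulr1 // pnatr_eq0.
  have step k : (k <= n.+1)%N -> nrm (T (k%:R * h) x) <= nrm x + 2 * `|M| * e * (k%:R * h).
    elim: k => [|k IH] kn; first by rewrite !mul0r T0 mulr0 addr0.
    have {}IH := IH (ltnW kn).
    have kh0 : 0 <= k%:R * h by rewrite mulr_ge0 // ltW.
    have khd : k%:R * h <= d.
      by apply: le_trans td; rewrite -hn ler_pM2r // ler_nat ltnW.
    have kS : k.+1%:R * h = k%:R * h + h by rewrite -natr1 mulrDl mul1r.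
    have Ak : rip (T (k.+1%:R * h) z) (T (k.+1%:R * h) x) <= 0.
      by apply/A_dissipative/semigroup_generator_shift; rewrite // kS addr_ge0 // ltW.
    apply: le_trans (dissipative_le h0 Ak) _.
    (* The defect of one implicit step, split so that differentiability of the orbit at [x] and
       continuity at [z] each contribute at most [e h]. *)
    pose r := (T h x - x - h%:C%C *: z) + h%:C%C *: (z - T h z).
    have -> : T (k.+1%:R * h) x - h%:C%C *: T (k.+1%:R * h) z =
        T (k%:R * h) x + T (k%:R * h) r.
      rewrite kS !Ta ?(ltW h0) // -linearZ -linearB -linearD /=; congr (T _ _).
      have -> : r = T h x - x - h%:C%C *: T h z by rewrite /r scalerBr addrA subrK.
      by rewrite addrA [x + _]addrC subrK.
    apply: le_trans (nrmD _ _) _; rewrite kS mulrDr addrA lerD //.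
    apply: le_trans (ME _ kh0 khd r) _.
    have hr : nrm r <= 2 * (e * h).
      apply: le_trans (nrmD _ _) _; rewrite nrmZr gtr0_norm //.
      have := d1P h h0 hd1; have := d2P h h0 hd2; nra.
    rewrite -!mulrA mulrCA ler_wpM2l //; lra.
  by have := step n.+1 (leqnn _); rewrite hn.
rewrite leNgt; apply/negP => lt.
have c0 : 0 < 2 * `|M| * t + 1 by rewrite ltr_wpDl // !mulr_ge0 // ltW.
have g0 : 0 < nrm (T t x) - nrm x by rewrite subr_gt0.
(* This [e] makes the accumulated error strictly smaller than the assumed excess of [nrm (T t x)]
   over [nrm x]. *)
have e0 : 0 < (nrm (T t x) - nrm x) / (2 * `|M| * t + 1) by rewrite divr_gt0.
have := key _ e0; have := divfK (lt0r_neq0 c0) (nrm (T t x) - nrm x).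
move: (_ / _) e0 => e e0; rewrite mulrDr mulr1 => E; nra.
Qed.

Hypothesis A_dense : dense [set x | exists z, A (x, z)].

Lemma semigroup_contraction : exists2 d : R, 0 < d &
  forall t x, 0 < t -> t <= d -> nrm (T t x) <= nrm x.
Proof.
have [Tc _ _ _] := T_C0.
have [d d0 dP] := semigroup_contraction_dom.
exists d => // t x t0 td; rewrite leNgt; apply/negP => lt.
have e0 : 0 < (nrm (T t x) - nrm x) / 2 by rewrite divr_gt0 // subr_gt0.
have /continuous_nrmP/(_ x _ e0)[c c0 cP] := Tc t (ltW t0).
have m0 : 0 < Num.min c ((nrm (T t x) - nrm x) / 2) by rewrite lt_min c0.
have /dense_nrmP/(_ x _ m0)[y [z Ayz]] := A_dense.
rewrite lt_min => /andP[/cP h1 h2].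
have := dP t y z t0 td Ayz; have := nrm_lipschitz (T t x) (T t y).
have := nrm_lipschitz y x; rewrite (nrmB y); lra.
Qed.

(* Along the orbit of [x] the functional [inner _ w] would grow like
   [(1 + h Re l) ^ k], although the orbit is bounded. *)
Lemma semigroup_range_orthogonal l w : Cplus l ->
  (forall x z, A (x, z) -> inner (l *: x - z) w = 0) -> w = 0.
Proof.
move=> /CplusE l0 lw; have [Tc T0 Ta _] := T_C0.
have [d d0 dP] := semigroup_contraction.
set a := complex.Re l in l0.
have small x z (e : R) : A (x, z) -> 0 < e -> cmod (inner x w) <= e * nrm w / a.
  move=> Axz e0; have [d' d'0 d'P] := semigroup_generator_diff Axz e0.
  pose h := Num.min d d' / 2.
  have m0 : 0 < Num.min d d' by rewrite lt_min d0.
  have h0 : 0 < h by rewrite divr_gt0.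
  have : h < Num.min d d' by rewrite /h; lra.
  rewrite lt_min => /andP[hd hd'].
  (* Contractivity is known for short times only; iterating it covers all multiples of [h]. *)
  have contr k y : nrm (T (k%:R * h) y) <= nrm y.
    elim: k => [|k IH]; first by rewrite mul0r T0.
    rewrite -natr1 mulrDl mul1r addrC Ta ?(ltW h0) //; last by rewrite mulr_ge0 // ltW.
    by apply: le_trans IH; apply: dP => //; exact: ltW.
  pose g k := cmod (inner (T (k%:R * h) x) w).
  have gS k : (1 + h * a) * g k - e * h * nrm w <= g k.+1.
    rewrite /g; set y := T (k%:R * h) x; pose r := T h x - x - h%:C%C *: z.
    have kh0 : 0 <= k%:R * h by rewrite mulr_ge0 // ltW.
    have -> : T (k.+1%:R * h) x = y + h%:C%C *: T (k%:R * h) z + T (k%:R * h) r.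
      rewrite -natr1 mulrDl mul1r Ta ?(ltW h0) // /y -linearZ -!linearD /=.
      by congr (T _ _); rewrite /r addrACA subrr addr0 [RHS]addrC subrK.
    have /eqP := lw _ _ (semigroup_generator_shift kh0 Axz).
    rewrite innerBl innerZl subr_eq0 => /eqP E.
    rewrite !innerDl innerZl -E -/y.
    have h1 : cmod (inner (T (k%:R * h) r) w) <= e * h * nrm w.
      apply: le_trans (cmod_inner_le _ _) _; rewrite ler_wpM2r ?nrm_ge0 //.
      by apply: le_trans (contr k r) _; exact: d'P.
    (* The modulus of [1 + h l] is at least its real part [1 + h a]. *)
    have h2 : (1 + h * a) * cmod (inner y w) <= cmod (inner y w + h%:C%C * (l * inner y w)).
      have -> : inner y w + h%:C%C * (l * inner y w) = (1 + h%:C%C * l) * inner y w.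
        by rewrite mulrDl mul1r mulrA.
      rewrite {2}/cmod normrM cmodE [`|inner y w|]cmodE -rmorphM /=.
      rewrite ler_wpM2r ?cmod_ge0 //; apply: le_trans (Rec_le_cmod _).
      by rewrite RecD RecZ.
    have := cmod_lipschitz (inner y w + h%:C%C * (l * inner y w)) (inner (T (k%:R * h) r) w).
    lra.
  have gb k : g k <= nrm x * nrm w.
    by apply: le_trans (cmod_inner_le _ _) _; rewrite ler_wpM2r ?nrm_ge0.
  rewrite leNgt; apply/negP => lt.
  (* [e * nrm w / a] is the fixed point of the affine recursion [gS]. A positive excess [D] over it
     grows at least linearly in [k], which contradicts [gb]. *)
  pose D := g 0%N - e * nrm w / a.
  have D0 : 0 < D by rewrite /D /g mul0r T0 subr_gt0.
  have aE : e * nrm w / a * a = e * nrm w by rewrite divfK // gt_eqF.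
  have grow k : (1 + k%:R * (h * a)) * D <= g k - e * nrm w / a.
    elim: k => [|k IH]; first by rewrite mul0r addr0 mul1r.
    rewrite -natr1; have := gS k; have k0 : 0 <= (k%:R : R) by [].
    have ha : 0 < h * a by rewrite mulr_gt0.
    have -> : e * h * nrm w = e * nrm w / a * (h * a).
      by rewrite (mulrC h a) [RHS]mulrA aE mulrAC.
    move: (e * nrm w / a) (k%:R : R) k0 (h * a) ha IH => E n n0 s s0 IH h1.
    have := ler_wpM2l (ltW (ltr_wpDl ler01 s0)) IH.
    have : 0 <= n * s * s * D by rewrite !mulr_ge0 // ltW.
    lra.
  have ha : 0 < h * a * D by apply: mulr_gt0 D0; exact: mulr_gt0.
  pose k := Num.truncn (nrm x * nrm w / (h * a * D)).
  have : nrm x * nrm w < k.+1%:R * (h * a * D) by rewrite -ltr_pdivrMr // truncnS_gt.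
  have := grow k.+1; have := gb k.+1.
  have : 0 <= e * nrm w / a.
    by apply: divr_ge0; [apply: mulr_ge0; [exact: ltW|exact: nrm_ge0]|exact: ltW].
  rewrite mulrDl mul1r -mulrA; lra.
have orth x z : A (x, z) -> inner x w = 0.
  move=> Axz; apply/eqP; rewrite -normr_eq0 cmodE; apply/eqP; congr (_%:C%C).
  apply/eqP; rewrite eq_le cmod_ge0 andbT leNgt; apply/negP => lt.
  have W0 : 0 < nrm w + 1 by rewrite ltr_wpDl ?nrm_ge0.
  have e0 : 0 < cmod (inner x w) * a / (nrm w + 1) by rewrite divr_gt0 ?mulr_gt0.
  have := small x z _ Axz e0; rewrite ler_pdivlMr // => h.
  have := divfK (lt0r_neq0 W0) (cmod (inner x w) * a).
  move: (_ / _) e0 h => e e0 h; have := mulr_gt0 lt l0; nra.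
by apply: (dense_orthogonal_eq0 A_dense) => x [z Axz]; rewrite innerC (orth x z) // rmorph0.
Qed.

(** Dissipativity yields [Re l |x| <= |l x - z|], so [closed_range] applies to the graph of [A];
    [semigroup_range_orthogonal] makes the range dense. The constant adds the resulting bounds for
    [x] and for [z]. *)
Lemma generator_resolvent l w : closed A -> Cplus l ->
  exists x z, A (x, z) /\ l *: x - z = w.
Proof.
move=> Ac lp; have Al := generator_lin; have /CplusE l0 := lp.
pose D (p : X * X) := l *: p.1 - p.2.
have DP a p q : D (a *: p + q) = a *: D p + D q.
  by rewrite /D /= scalerDr !scalerA (mulrC l) -!scalerA opprD addrACA -scalerBr.
have DB p q : D (p - q) = D p - D q by rewrite addrC -scaleN1r DP scaleN1r addrC.
have : (D @` A) w; last by move=> [[x z] Axz <-]; exists x, z.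
apply: (@closed_range _ _ _ A D (1 + (1 + cmod l) / complex.Re l) (cmod l + 1)) => //.
- by apply: nrm_complete_pair; exact: cauchy_nrm_cvg.
- move=> [x z]; rewrite /D /=; have := nrmD (l *: x) (- z); rewrite nrmN nrmZ.
  have := nrm_fst (x, z); have := nrm_snd (x, z); have := cmod_ge0 l => /=; nra.
- move=> [x z] Axz; set d := nrm (D (x, z)).
  have xd : complex.Re l * nrm x <= d.
    have [x0|x0] := eqVneq (nrm x) 0; first by rewrite x0 mulr0 nrm_ge0.
    have {}x0 : 0 < nrm x by rewrite lt_neqAle eq_sym x0 nrm_ge0.
    have := rip_le (D (x, z)) x; rewrite ripDl ripNl /= rip_scale_diag -/d.
    have := A_dissipative Axz => h1 h2; rewrite -(ler_pM2r x0); lra.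
  have zd : nrm z <= cmod l * nrm x + d.
    by have := nrm_lipschitz z (l *: x); rewrite nrmZ nrmB.
  have := nrm_pair x z; have := nrm_ge0 x; have := cmod_ge0 l.
  have xd' : nrm x <= d / complex.Re l by rewrite ler_pdivlMr // mulrC.
  rewrite mulrDl mul1r -mulrA (mulrC _^-1); nra.
- have : dense (D @` A).
    apply: dense_orthogonal => [|w' w'D].
      split; first by exists 0; [exact: Al.1|rewrite /D /= scaler0 subr0].
      move=> a _ _ [p Ap <-] [q Aq <-]; exists (a *: p + q) => //; exact: Al.2.
    apply: (semigroup_range_orthogonal lp) => x z Axz.
    have /w'D : (D @` A) (l *: x - z) by exists (x, z).
    by move=> h; rewrite innerC h rmorph0.
  by move=> /dense_nrmP dD; apply/closure_nrmP => e /(dD w).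
Qed.
End Semigroup.

(** * Extrapolation spaces *)

Section Extrapolation.
Variables (R : realType) (X : hilbertType R) (A : set (X * X)).
Hypothesis (A_dense : dense [set x | exists z, A (x, z)]).
Variable E : extrapolation_space A.

Lemma resolventE l (Q : {linear X -> X}) :
  (forall w, A (Q w, l *: Q w - w)) -> (forall x z, A (x, z) -> Q (l *: x - z) = x) ->
  forall w, resolvent A l w = Q w.
Proof.
move=> AQ QA w; rewrite /resolvent; case: xgetP => [x _ [z Axz <-]|]; first by rewrite QA.
by move=> /(_ (Q w))[]; exists (l *: Q w - w) => //; rewrite opprB addrC subrK.
Qed.

(** [b - A_{-1}] is isometric: on the domain of [A] the norm of the extrapolation space undoes
    [b - A] exactly, and density with continuity carries this far enough to see that the kernel is
    trivial. *)
Lemma xm1_isometry_inj x : xm1_beta E *: xm1_inj E x = xm1_op E x -> x = 0.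
Proof.
have [Q [Qc AQ QA]] := xm1_beta_res E.
move: (xm1_beta E) (xm1_norm E) AQ QA => b bn AQ QA.
have injn y : nrm (xm1_inj E y) = nrm (Q y).
  by rewrite /nrm bn (resolventE AQ QA).
pose F y := b *: xm1_inj E y - xm1_op E y.
have Fc : continuous F.
  move=> y; apply: cvgB; last exact: xm1_op_continuous.
  apply: cvgZr; apply: (_ : continuous (xm1_inj E)).
  apply/continuous_nrmP => y' e e0.
  have /continuous_nrmP/(_ y' e e0)[d d0 dP] := Qc.
  by exists d => // z /dP; rewrite -!linearB injn.
have Fn y z : A (y, z) -> nrm (F y) = nrm y.
  move=> Ayz; rewrite /F (xm1_op_ext E Ayz) -linearZ -linearB.
  by rewrite injn QA.
move=> Fx; apply: nrm_small => e e0.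
have e2 : 0 < e / 2 by rewrite divr_gt0.
have /continuous_nrmP/(_ x _ e2)[d d0 dP] := Fc.
have m0 : 0 < Num.min d (e / 2) by rewrite lt_min d0.
have /dense_nrmP/(_ x _ m0)[y [z Ayz]] := A_dense.
rewrite lt_min => /andP[/dP + xy].
rewrite {1}/F Fx subrr sub0r nrmN (Fn y z Ayz).
have := nrm_lipschitz x y; lra.
Qed.

(** An eigenvector of [A_{-1}] in the state space already lies in the domain of [A]: it and
    [Q ((b - l) *: x)] have the same image under the injective [b - A_{-1}]. *)
Lemma xm1_op_graph l x : xm1_op E x = l *: xm1_inj E x -> A (x, l *: x).
Proof.
move=> opx; have [Q [Qc AQ QA]] := xm1_beta_res E.
set b := xm1_beta E in AQ QA.
have Ax' := AQ ((b - l) *: x); set x' := Q _ in Ax'.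
have /eqP : x - x' = 0.
  apply: xm1_isometry_inj; rewrite !linearB /= opx (xm1_op_ext E Ax') -/b.
  rewrite linearB !linearZ /=.
  rewrite !scalerN scalerBl opprD opprK addrCA [l *: _ + _]addrC subrK.
  exact: addrC.
rewrite subr_eq0 => /eqP xx'; move: Ax'; rewrite -xx' -scalerBl.
by rewrite opprB addrC subrK.
Qed.

Lemma xm1_op_inj l x : (forall y, A (y, l *: y) -> y = 0) ->
  l *: xm1_inj E x - xm1_op E x = 0 -> x = 0.
Proof. by move=> Al /eqP; rewrite subr_eq0 => /eqP lx; exact/Al/xm1_op_graph. Qed.

End Extrapolation.

Section InputResolvent.
Variables (R : realType) (U X Y : hilbertType R).
Variable S : set ((X * U) * (X * Y)).

(** The bridge from the extrapolation space to the graph: [x] solves the equation that defines the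
    input resolvent, and injectivity of [l - A_{-1}] makes the chosen solution equal to it. *)
Lemma input_resolventE (E : extrapolation_space (main_op S)) (B : {linear U -> E}) l nu x y :
  dense [set x | exists z, main_op S (x, z)] -> control_op B ->
  (forall x, main_op S (x, l *: x) -> x = 0) ->
  S ((x, nu), (l *: x, y)) -> input_resolvent B l nu = x.
Proof.
move=> Sd [_ Bc] Sl Sxy.
have xB : l *: xm1_inj E x - xm1_op E x = B nu.
  have AB : AB_row S ((x, nu), l *: x) by exists y.
  have := Bc _ _ _ AB; rewrite linearZ => ->; rewrite addrC; exact: addKr.
rewrite /input_resolvent; case: xgetP => [x' _ x'B|/(_ x)/(_ xB) //].
apply/eqP; rewrite -subr_eq0; apply/eqP.
apply: (xm1_op_inj (E := E) Sd Sl).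
rewrite !linearB /= addrACA -opprD xB.
by move: x'B => /= ->; rewrite subrr.
Qed.

End InputResolvent.

(** * Reproducing kernels and generated relations *)

Section Orthogonality.
Variables (R : realType) (V : hilbertType R).

Lemma dense_lspanP (G : set V) :
  dense (lspan G) <-> forall w, (forall g, G g -> inner w g = 0) -> w = 0.
Proof.
rewrite dense_orthogonalP; last exact: lspan_lin.
split=> H w wG; apply: H => g Gg; last exact: (wG _ (lspan_gen Gg)).
apply: (@lspan_sub _ _ G [set g | inner w g = 0]) Gg => //.
by split=> [|a x y /= wx wy]; rewrite /= ?inner0r // innerDr innerZr wx wy mulr0 addr0.
Qed.

End Orthogonality.

Section ReproducingKernels.
Variables (R : realType) (H W : hilbertType R).
Variables (ev : R[i] -> {linear H -> W}) (K : R[i] -> R[i] -> W -> W).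
Hypothesis rkhs : is_rkhs ev K.

Lemma rkhs_adjointE l nu f : Cplus l ->
  inner f (adjoint (ev l) nu) = inner (ev l f) nu.
Proof.
have [_ _ kP] := rkhs; move=> /(kP l nu)[k [_ k_inner]].
by rewrite (adjointE (v := k)).
Qed.

Lemma rkhs_adjoint_ev l m nu : Cplus l -> Cplus m ->
  ev m (adjoint (ev l) nu) = K m l nu.
Proof.
have [_ _ kP] := rkhs; move=> lp mp; have [k [kE k_inner]] := kP l nu lp.
by rewrite (adjointE (v := k)) ?kE.
Qed.

Lemma rkhs_ext f g : (forall l nu, Cplus l ->
    inner f (adjoint (ev l) nu) = inner g (adjoint (ev l) nu)) -> f = g.
Proof.
have [_ ext _] := rkhs => fg; apply: ext => m mp.
apply: inner_inj => nu; rewrite innerC [RHS]innerC.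
by rewrite -!rkhs_adjointE // fg.
Qed.

(** Differentiability gives continuity, so one point may be left out; a real shift by [d / 2] stays
    in the half-plane and avoids it. *)
Lemma rkhs_eq0 l f : (forall m, Cplus m -> m != l -> ev m f = 0) -> f = 0.
Proof.
have [der ext _] := rkhs => f0; apply: ext => m mp; rewrite linear0.
have [ml|] := eqVneq m l; last exact: f0.
have /derivable1_diffP/differentiable_continuous fc := der f m mp.
apply: nrm_small => e e0.
have /fc/nrm_ballP[d d0 dP] : nbhs (ev m f) [set y | nrm (ev m f - y) < e].
  by apply/nrm_ballP; exists e.
have := dP (m + (d / 2)%:C%C); rewrite /= (f0 (m + (d / 2)%:C%C)).
- rewrite subr0; apply; rewrite opprD addNKr.
  rewrite nrmN /nrm normc_def /= expr0n addr0 sqrtr_sqr gtr0_norm; lra.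
- by move/CplusE: mp => mp; apply/CplusE; rewrite RecD /=; lra.
- rewrite ml; apply/eqP => /(congr1 (@complex.Re R)); rewrite RecD /=; lra.
Qed.

End ReproducingKernels.

(* The closed relation spanned by [((e l nu, nu), (l *: e l nu, psi l nu))];
   the Gram identity says that it preserves energy. *)
Section GeneratedRelation.
Variables (R : realType) (U X Y : hilbertType R).
Variables (e : R[i] -> U -> X) (psi : R[i] -> U -> Y).

Definition generated_relation : set ((X * U) * (X * Y)) :=
  closure (lspan [set p | exists l nu, Cplus l /\
    p = ((e l nu, nu), (l *: e l nu, psi l nu))]).

Hypothesis gram : forall l m nu mu, Cplus l -> Cplus m ->
  (l + m^*) * inner (e l nu) (e m mu) = inner nu mu - inner (psi l nu) (psi m mu).
Hypothesis sep : forall w,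
  (forall l nu, Cplus l -> l != 1 -> inner w (e l nu) = 0) -> w = 0.

Lemma generated_gen l nu : Cplus l ->
  generated_relation ((e l nu, nu), (l *: e l nu, psi l nu)).
Proof. by move=> lp; apply: subset_closure; apply: lspan_gen; exists l, nu. Qed.

Lemma generated_lin : lin_subspace generated_relation.
Proof. exact/lin_subspace_closure/lspan_lin. Qed.

Lemma generated_energy : energy_preserving generated_relation.
Proof.
apply/(energy_kform generated_lin) => p q; apply: kform_closure_span.
move=> {}p {}q [l [nu [lp ->]]] [m [mu [mp ->]]]; rewrite /kform /=.
rewrite innerZl innerZr -mulrDl gram //.
by rewrite addrAC subrK subrr.
Qed.

Lemma generated_passive : passive generated_relation.
Proof.
by apply/passiveE => x u z y /(energy_preservingE _).1 ->; [exact: lexx|exact: generated_energy].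
Qed.

(** Two generators with the same [nu], at [l] and at 1, differ by an element with zero input for
    which [x - z] is [(1 - l) *: e l nu]; these vectors are total by [sep]. *)
Lemma generated_range : node_range generated_relation.
Proof.
apply: node_range_of_dense.
- exact: generated_lin.
- exact: closed_closure.
- exact: generated_passive.
- move=> u; exists (e 1 u), (1 *: e 1 u), (psi 1 u).
  exact/generated_gen/Cplus1.
have shifted l nu : Cplus l -> generated_relation
    ((e l nu - e 1 nu, 0), (l *: e l nu - e 1 nu, psi l nu - psi 1 nu)).
  move=> lp.
  have := lin_subspaceB generated_lin (generated_gen (nu := nu) lp)
    (generated_gen (nu := nu) (@Cplus1 R)).
  have -> : (e l nu, nu, (l *: e l nu, psi l nu)) - (e 1 nu, nu, (1 *: e 1 nu, psi 1 nu)) =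
     ((e l nu - e 1 nu, nu - nu), (l *: e l nu - 1 *: e 1 nu, psi l nu - psi 1 nu)) by [].
  by rewrite subrr scale1r.
apply: dense_orthogonal => [|w wM].
  have Gl := generated_lin; split.
    by exists 0, 0, 0; split; [exact: Gl.1|rewrite subr0].
  move=> a _ _ [x [z [y [Gx <-]]]] [x' [z' [y' [Gx' <-]]]].
  exists (a *: x + x'), (a *: z + z'), (a *: y + y'); split.
    have := Gl.2 a _ _ Gx Gx'.
    have -> : a *: (x, 0 : U, (z, y)) + (x', 0, (z', y')) =
      ((a *: x + x', a *: 0 + 0), (a *: z + z', a *: y + y')) by [].
    by rewrite scaler0 addr0.
  by rewrite scalerBr opprD addrACA.
apply: sep => l nu lp l1.
have /eqP : inner w ((1 - l) *: e l nu) = 0.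
  apply: wM; exists (e l nu - e 1 nu), (l *: e l nu - e 1 nu), (psi l nu - psi 1 nu).
  split; first exact: shifted.
  by rewrite opprB addrA subrK scalerBl scale1r.
rewrite innerZr mulf_eq0 conjC_eq0 subr_eq0 eq_sym (negPf l1) /=.
by move/eqP.
Qed.

End GeneratedRelation.

(** * Passive system nodes *)

Lemma subr_exchange (V : zmodType) (a b c d : V) : a - b = c - d -> d - b = c - a.
Proof.
move=> E; apply/eqP; rewrite -subr_eq0.
have -> : d - b - (c - a) = a - b - (c - d).
  by rewrite !opprB addrACA (addrC d) -addrACA.
by rewrite E subrr.
Qed.

Section SingleValued.
Variables (K : numFieldType) (V W : lmodType K).

Lemma op_appE (G : set (V * W)) x y :
  (forall y y', G (x, y) -> G (x, y') -> y = y') -> G (x, y) -> op_app G x = y.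
Proof.
by move=> Gf Gxy; rewrite /op_app; case: xgetP => [y' _ Gxy'|/(_ y)/(_ Gxy) //]; exact: Gf.
Qed.

End SingleValued.

Lemma intertwines_graph (R : realType) (U X0 X1 Y : hilbertType R)
    (S0 : set ((X0 * U) * (X0 * Y))) (S1 : set ((X1 * U) * (X1 * Y)))
    (E : {linear X0 -> X1}) :
  contractive E ->
  (forall w p p', S1 (w, p) -> S1 (w, p') -> p = p') ->
  (forall x u z y, S0 ((x, u), (z, y)) -> S1 ((E x, u), (E z, y))) ->
  intertwines S0 S1 E.
Proof.
move=> /contractive_nrm Ec S1f ES; split.
- by apply: (@lipschitz_continuous _ _ _ _ 1) => x y; rewrite -linearB mul1r.
- by move=> _ [[x u] [[z y] /ES S1p] <-]; exists (E z, y).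
- move=> [x u] [[z y] S0p].
  have : S0 ((x, u), op_app S0 (x, u)).
    by rewrite /op_app; case: xgetP => [//|/(_ (z, y))].
  case: (op_app S0 _) => z' y' /ES S1p; apply/esym/op_appE => //.
  by move=> p p'; exact: S1f.
Qed.

Section PassiveNode.
Variables (R : realType) (U X Y : hilbertType R).
Variable S : set ((X * U) * (X * Y)).
Hypotheses (nodeS : system_node S) (passS : passive S).

Let S_lin : lin_subspace S. Proof. by have [[]] := nodeS. Qed.

Lemma node_fun w p p' : S (w, p) -> S (w, p') -> p = p'.
Proof. by have [[_ Sf] _ _ _ _] := nodeS; exact: Sf. Qed.

Lemma node_sub x u z y x' u' z' y' :
  S ((x, u), (z, y)) -> S ((x', u'), (z', y')) -> S ((x - x', u - u'), (z - z', y - y')).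
Proof. by move=> Sp Sq; exact: (lin_subspaceB S_lin Sp Sq). Qed.

Lemma node_main_eq0 l x : Cplus l -> main_op S (x, l *: x) -> x = 0.
Proof. by move=> lp [y /= /(passive_eq0 passS lp)[]]. Qed.

Lemma node_input_unique l nu x y x' y' : Cplus l ->
  S ((x, nu), (l *: x, y)) -> S ((x', nu), (l *: x', y')) -> x = x' /\ y = y'.
Proof.
move=> lp Sx Sx'; have := node_sub Sx Sx'.
rewrite subrr -scalerBr => /(passive_eq0 passS lp)[/eqP + /eqP].
by rewrite !subr_eq0 => /eqP -> /eqP ->.
Qed.

Section Resolvent.
Variable b : R[i].
Hypothesis b_res : resolvent_set (main_op S) b.

Lemma node_dom_dense : dense [set x | exists z, main_op S (x, z)].
Proof.
have [_ _ _ [T [TC AT]] _] := nodeS.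
by have := b_res; rewrite AT; exact: generator_dense.
Qed.

(** The main operator inherits closedness from the row [A&B] as its slice at zero input, and
    dissipativity from passivity at zero input. *)
Lemma node_resolvent l w : Cplus l -> exists x z y,
  S ((x, 0), (z, y)) /\ l *: x - z = w.
Proof.
move=> lp; have [_ _ Ac [T [TC AT]] _] := nodeS.
have Amc : closed (main_op S).
  apply: closed_nrmP => -[x z] xz; apply: Ac; apply/closure_nrmP => e /xz[[x' z'] Axz' xz'].
  exists ((x', 0), z') => //; apply: le_lt_trans xz'.
  have -> : ((x, 0, z) - (x', 0, z') : X * U * X) = ((x - x', 0 - 0), z - z') by [].
  have -> : ((x, z) - (x', z') : X * X) = (x - x', z - z') by [].
  rewrite subr0 nrm_pairE ge_max nrm_pairr andbT nrm_pairE nrm0 ge_max nrm_ge0 andbT.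
  exact: nrm_pairl.
have Ad x z : sg_generator T (x, z) -> rip z x <= 0.
  rewrite -AT => -[y /= /(passiveE _).1 -/(_ passS)].
  by rewrite nrm0 expr0n /= sub0r; have := sqr_ge0 (nrm y); lra.
have Adense := node_dom_dense.
have [||x [z [Axz E]]] := generator_resolvent TC Ad _ w _ lp.
- by rewrite -AT.
- by rewrite -AT.
by move: Axz; rewrite -AT => -[y Sxz]; exists x, z, y.
Qed.

(** Take any graph element with input [nu] and subtract the zero-input element that solves the
    resolvent equation for its defect [l *: x0 - z0]. *)
Lemma node_input l nu : Cplus l -> exists x y, S ((x, nu), (l *: x, y)).
Proof.
move=> lp; have [_ _ _ _ /(_ nu)[x0 [[z0 y0] S0]]] := nodeS.
have [x1 [z1 [y1 [S1 E]]]] := node_resolvent (l *: x0 - z0) lp.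
exists (x0 - x1), (y0 - y1); have := node_sub S0 S1; rewrite subr0.
suff -> : z0 - z1 = l *: (x0 - x1) by [].
by rewrite scalerBr; exact: subr_exchange.
Qed.

Lemma node_rangeP : node_range S.
Proof.
move=> w u; have [x [y Sx]] := node_input u (@Cplus1 R).
have [x' [z' [y' [Sx' E]]]] := node_resolvent w (@Cplus1 R).
exists (x + x'), (1 *: x + z'), (y + y'); split.
  have := lin_subspaceD S_lin Sx Sx'.
  have -> : (x, u, (1 *: x, y)) + (x', 0, (z', y')) =
    ((x + x', u + 0), (1 *: x + z', y + y')) by [].
  by rewrite addr0.
by rewrite opprD addrACA scale1r subrr add0r -E scale1r.
Qed.

Lemma output_resolventE l q z c : Cplus l ->
  S ((q, 0), (z, c)) -> output_resolvent S l (l *: q - z) = c.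
Proof.
move=> lp Sq; rewrite /output_resolvent.
have -> : resolvent (main_op S) l (l *: q - z) = q.
  rewrite /resolvent; case: xgetP => [q' _ [z' [y' /= Sq'] E]|/(_ q)[]]; last first.
    by exists z => //; exists c.
  have := node_sub Sq' Sq; rewrite subrr.
  have -> : z' - z = l *: (q' - q).
    by rewrite scalerBr; apply: subr_exchange; rewrite E.
  by move=> /(passive_eq0 passS lp)[/eqP + _]; rewrite subr_eq0 => /eqP.
apply: op_appE; last by exists z.
by move=> y y' [z1 /= S1] [z2 /= S2]; have [] := node_fun S1 S2.
Qed.

End Resolvent.

Variables (E : extrapolation_space (main_op S)) (B : {linear U -> E}).
Hypothesis ctrlB : control_op B.
Variable phi : R[i] -> U -> Y.
Hypothesis phiE : forall l nu, Cplus l -> phi l nu = transfer B l nu.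

Lemma node_gen l nu : Cplus l ->
  S ((input_resolvent B l nu, nu), (l *: input_resolvent B l nu, phi l nu)).
Proof.
move=> lp; have [x [y Sx]] := node_input (xm1_beta_res E) nu lp.
have xE : input_resolvent B l nu = x.
  apply: input_resolventE Sx => //; first exact: node_dom_dense (xm1_beta_res E).
  by move=> x'; exact: node_main_eq0.
rewrite phiE // /transfer xE (op_appE (y := y)) //; last by exists (l *: x).
by move=> y' y'' [z1 /= S1] [z2 /= S2]; have [] := node_fun S1 S2.
Qed.

Lemma transfer_linear l : Cplus l ->
  forall a nu mu, phi l (a *: nu + mu) = a *: phi l nu + phi l mu.
Proof.
move=> lp a nu mu.
have := S_lin.2 a _ _ (node_gen nu lp) (node_gen mu lp).
set xn := input_resolvent B l nu; set xm := input_resolvent B l mu.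
have -> : a *: (xn, nu, (l *: xn, phi l nu)) + (xm, mu, (l *: xm, phi l mu)) =
  ((a *: xn + xm, a *: nu + mu), (a *: (l *: xn) + l *: xm, a *: phi l nu + phi l mu)) by [].
rewrite scalerA mulrC -scalerA -scalerDr => Sx.
by have [] := node_input_unique lp (node_gen (a *: nu + mu) lp) Sx.
Qed.

Lemma transfer_contractive l : Cplus l -> contractive (phi l).
Proof.
move=> lp; apply/contractive_nrm => nu.
have /(passiveE _).1 := node_gen nu lp => /(_ passS).
rewrite rip_scale_diag => h; move/CplusE: lp => lp.
rewrite -ler_sqr ?nnegrE ?nrm_ge0 //.
have := sqr_ge0 (nrm (input_resolvent B l nu)); nra.
Qed.

Lemma transfer_adjoint l nu w : Cplus l ->
  inner (phi l nu) w = inner nu (adjoint (phi l) w).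
Proof. by move=> lp; apply: adjointP; [exact: transfer_linear|exact: transfer_contractive]. Qed.

End PassiveNode.

(** * Adjoints and the observable model *)

Section NodeAdjoint.
Variables (R : realType) (U X Y : hilbertType R).
Implicit Types S G : set ((X * U) * (X * Y)).

(** The swap and sign change that turn membership in the adjoint into orthogonality for [kform], so
    that facts about the form also serve adjoints. *)
Definition adjoint_flip (q : (X * Y) * (X * U)) : (X * U) * (X * Y) :=
  ((q.1.1, q.2.2), (- q.2.1, q.1.2)).

Lemma node_adjointE S q :
  node_adjoint S q <-> forall p, S p -> kform p (adjoint_flip q) = 0.
Proof.
have E p : kform p (adjoint_flip q) =
    inner p.2.1 q.1.1 + inner p.2.2 q.1.2 - (inner p.1.1 q.2.1 + inner p.1.2 q.2.2).
  by rewrite /kform /= innerNr; ring.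
by split=> Sq p /Sq; rewrite E => /eqP; [move=> /eqP ->; rewrite subrr|rewrite subr_eq0 => /eqP].
Qed.

Lemma adjoint_flip_lin a q q' :
  adjoint_flip (a *: q + q') = a *: adjoint_flip q + adjoint_flip q'.
Proof.
have -> : a *: adjoint_flip q + adjoint_flip q' =
  ((a *: q.1.1 + q'.1.1, a *: q.2.2 + q'.2.2),
   (a *: - q.2.1 - q'.2.1, a *: q.1.2 + q'.1.2)) by [].
by rewrite scalerN -opprD.
Qed.

Lemma node_adjoint_lin S : lin_subspace (node_adjoint S).
Proof.
split=> [|a q q' /node_adjointE Sq /node_adjointE Sq'].
  by move=> p _; rewrite /= !inner0r.
by apply/node_adjointE => p Sp; rewrite adjoint_flip_lin kform_Pr Sq // Sq' // mulr0 addr0.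
Qed.

Lemma node_adjoint_closed S : closed (node_adjoint S).
Proof.
have -> : node_adjoint S = \bigcap_(p in S) (adjoint_flip @^-1` [set q | kform q p = 0]).
  apply/seteqP; split=> q.
    by move=> /node_adjointE Sq p Sp /=; rewrite kformC Sq // rmorph0.
  move=> Sq; apply/node_adjointE => p Sp.
  by rewrite kformC [X in X^*](Sq p Sp) rmorph0.
apply: closed_bigI => p _; apply: preimage_closed; last exact: closed_kform.
move=> x _; apply: (@lipschitz_continuous _ _ _ adjoint_flip 1) => {x} q q'.
rewrite mul1r; case: q q' => [[x y] [z u]] [[x' y'] [z' u']].
have -> : adjoint_flip (x, y, (z, u)) - adjoint_flip (x', y', (z', u')) =
   ((x - x', u - u'), (- z - - z', y - y')) by [].
have -> : (x, y, (z, u)) - (x', y', (z', u')) = ((x - x', y - y'), (z - z', u - u')) by [].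
rewrite !nrm_pairE -opprD nrmN.
by rewrite !ge_max !le_max !lexx !orbT.
Qed.

Lemma node_adjoint_closure_span G q :
  node_adjoint G q -> node_adjoint (closure (lspan G)) q.
Proof.
move=> /node_adjointE Gq; apply/node_adjointE; apply: closure_sub; first exact: closed_kform.
apply: lspan_sub => //; split=> [|a p p' /= pq p'q].
  by rewrite /= /kform /= !inner0l subr0 !addr0.
by rewrite kform_Pl pq p'q mulr0 addr0.
Qed.

End NodeAdjoint.

Section ObservableModel.
Variables (R : realType) (U Y Ho : hilbertType R).
Variables (phi : R[i] -> U -> Y) (eo : R[i] -> {linear Ho -> Y}).
Hypothesis rkhs : is_rkhs eo (kernel_o phi).
Hypothesis phi_lin : forall l, Cplus l ->
  forall a nu mu, phi l (a *: nu + mu) = a *: phi l nu + phi l mu.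
Hypothesis phi_adj : forall l nu w, Cplus l ->
  inner (phi l nu) w = inner nu (adjoint (phi l) w).

Let ker l g := adjoint (eo l^*) g.
Let psi l g := adjoint (phi l^*) g.
Let So := model_o phi eo.

Lemma model_o_gram l m g d : Cplus l -> Cplus m ->
  (l + m^*) * inner (ker l g) (ker m d) = inner g d - inner (psi l g) (psi m d).
Proof.
move=> lp mp; have lp' := CplusJ lp; have mp' := CplusJ mp.
rewrite (rkhs_adjointE rkhs) // (rkhs_adjoint_ev rkhs) // /kernel_o conjcc.
rewrite innerZl innerBl phi_adj // (addrC l) mulrA mulfV ?mul1r //.
exact: CplusD_neq0.
Qed.

Lemma model_o_sep w :
  (forall l g, Cplus l -> l != 1 -> inner w (ker l g) = 0) -> w = 0.
Proof.
move=> wk; apply: (rkhs_eq0 rkhs (l := 1)) => m mp m1.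
apply: inner_inj => g; rewrite inner0r innerC -(rkhs_adjointE rkhs) //.
rewrite -[m in eo m]conjcc -/(ker _ _) wk ?rmorph0 //; first exact: CplusJ.
by apply: contra m1 => /eqP/(congr1 (@Num.conj R[i])); rewrite conjcc rmorph1 => ->.
Qed.

Let V := generated_relation ker psi.

Let V_range : node_range V.
Proof. exact: generated_range model_o_gram model_o_sep. Qed.

Let V_passive : passive V.
Proof. exact: generated_passive model_o_gram. Qed.

(** Pairing [f] with the kernel function at a real point [t] gives [|c|^2 <= |f| |k_t c|], while the
    Gram identity bounds [|k_t c|^2] by [|c|^2 / (2 t)]; large [t] forces [c = 0]. This is the
    uniqueness of the output [y] in the model. *)
Lemma model_o_const f c : (forall m, Cplus m -> eo m f = c) -> c = 0.
Proof.
move=> fc; apply: nrm_le0; rewrite leNgt; apply/negP => c0.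
have c2 : 0 < nrm c ^+ 2 by rewrite exprn_gt0.
(* Large enough that the two bounds combine to [2 (|f|^2 + 1) <= |f|^2]. *)
pose t : R := (nrm f ^+ 2 + 1) / nrm c ^+ 2.
have t0 : 0 < t by rewrite divr_gt0 // ltr_wpDl ?sqr_ge0.
have tp : Cplus t%:C%C by apply/CplusE.
have tJ : (t%:C%C)^* = t%:C%C :> R[i] by exact: conjc_real.
have tc : t * nrm c ^+ 2 = nrm f ^+ 2 + 1 by rewrite divfK ?gt_eqF.
have kn : 2 * t * nrm (ker t%:C%C c) ^+ 2 <= nrm c ^+ 2.
  have /(congr1 (@complex.Re R)) := model_o_gram c c tp tp.
  rewrite tJ -rmorphD RecZ -/(rip _ _) RecB -!/(rip _ _) !rip_nrm.
  by have := sqr_ge0 (nrm (psi t%:C%C c)); lra.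
have fk : nrm c ^+ 2 <= nrm f * nrm (ker t%:C%C c).
  rewrite -rip_nrm -{1}(fc _ tp) -[X in eo X]tJ /rip -(rkhs_adjointE rkhs) ?tJ //.
  by have := rip_le f (ker t%:C%C c); rewrite /ker tJ.
move: (nrm (ker _ c)) (nrm f) (nrm c ^+ 2) c2 tc kn fk (nrm_ge0 (ker t%:C%C c)) (nrm_ge0 f).
move=> k F C C0 tc kn fk k0 F0.
have h1 : C * C <= F ^+ 2 * k ^+ 2 by rewrite -exprMn -expr2 ler_sqr ?nnegrE ?(ltW C0) ?mulr_ge0.
have h2 : 2 * t * (C * C) <= F ^+ 2 * C.
  have := ler_wpM2l (ltW t0) h1; have := ler_wpM2l (sqr_ge0 F) kn; lra.
have := sqr_ge0 F; nra.
Qed.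

Let phi0 l : Cplus l -> phi l 0 = 0.
Proof.
move=> lp; apply: (addrI (phi l 0)).
by have := phi_lin lp 1 0 0; rewrite !scale1r !addr0.
Qed.

Lemma model_o_lin : lin_subspace So.
Proof.
split=> [m mp|a p q Sp Sq m mp] /=; first by rewrite phi0 // !linear0 !addr0.
rewrite !linearP /= Sp // Sq // phi_lin // scalerBr scalerDr.
rewrite addrACA [X in X + _]addrACA -opprD.
by rewrite scalerN -opprD.
Qed.

Lemma model_o_fun w p p' : So (w, p) -> So (w, p') -> p = p'.
Proof.
have [_ ext _] := rkhs.
case: w p p' => [x u] [z y] [z' y'] Sp Sp'.
have yy : y = y'.
  apply/eqP; rewrite eq_sym -subr_eq0; apply/eqP/(@model_o_const (z - z')) => m mp.
  by rewrite linearB Sp // Sp' //= opprB [LHS]addrC subrKA.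
by rewrite yy in Sp *; congr (_, _); apply: ext => m mp; rewrite Sp // Sp'.
Qed.

Lemma model_o_sub_adjoint p : So p -> node_adjoint V p.
Proof.
move=> Sp; apply: node_adjoint_closure_span => _ [l [g [lp ->]]] /=.
have lp' := CplusJ lp; have := Sp _ lp'.
case: p {Sp} => [[x u] [z y]] /= Sp.
have h : inner z (ker l g) = l^* * inner x (ker l g) + inner u (psi l g) - inner y g.
  rewrite !(rkhs_adjointE rkhs) // Sp innerBl innerDl innerZl phi_adj //.
rewrite !innerZl (innerC _ z) (innerC _ x) (innerC (psi l g)) (innerC g).
rewrite h !rmorphD rmorphM /= conjcc rmorphN /=; ring.
Qed.

(** The energy inequality is inherited from the adjoint of [V], which is passive because the Cayley
    transform of [V] is everywhere defined. *)
Lemma model_o_dissipative x z y : So ((x, 0), (z, y)) -> 2 * rip z x <= - nrm y ^+ 2.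
Proof.
move=> /model_o_sub_adjoint/((passiveE _).1 (passive_adjoint V_passive V_range)).
by rewrite nrm0 expr0n /=; lra.
Qed.

(** Evaluation at [l] itself forces [y = 0]; then [(l - m) x(m) = 0] at every other point [m], and
    continuity settles the point [l]. *)
Lemma model_o_main_eq0 l x : Cplus l -> main_op So (x, l *: x) -> x = 0.
Proof.
move=> lp [y Sx].
have y0 : y = 0.
  have := Sx l lp; rewrite /= linearZ phi0 //= addr0 => /eqP.
  by rewrite eq_sym -subr_eq0 addrAC subrr add0r oppr_eq0 => /eqP.
apply: (rkhs_eq0 rkhs (l := l)) => m mp ml.
have := Sx m mp; rewrite /= linearZ phi0 //= y0 subr0 addr0 => /eqP.
by rewrite -subr_eq0 -scalerBl scaler_eq0 subr_eq0 eq_sym (negPf ml) => /eqP.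
Qed.

(* The functional [f |-> inner p w], where [((p, 0), (p - f, _))] lies in [V],
   is bounded; its Riesz vector is [(1 - A)^-1 w] for the main operator [A]
   of the model. *)
Lemma model_o_main_range w : exists x y, So ((x, 0), (x - w, y)).
Proof.
have step f : exists p, exists d, V ((p, 0), (p - f, d)).
  by have [x [z [d [Vx <-]]]] := V_range f 0; exists x, d; rewrite subKr.
have [P PV] := choice step.
have V_lin : lin_subspace V by exact: generated_lin.
have PE f p d : V ((p, 0), (p - f, d)) -> P f = p.
  have [d' Vd'] := PV f => Vd; have h := lin_subspaceB V_lin Vd' Vd.
  have [] := @passive_eq0 _ _ _ _ V 1 (P f - p) (d' - d) V_passive (@Cplus1 R).
    move: h.
    have -> : (P f, 0, (P f - f, d')) - (p, 0, (p - f, d)) =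
      ((P f - p, (0 : Y) - 0), (P f - f - (p - f), d' - d)) by [].
    by rewrite subrr scale1r opprB addrA subrK.
  by move=> /eqP; rewrite subr_eq0 => /eqP.
have Plin a f g : P (a *: f + g) = a *: P f + P g.
  have [d Vd] := PV f; have [d' Vd'] := PV g.
  apply: (PE _ _ (a *: d + d')); have := V_lin.2 a _ _ Vd Vd'.
  have -> : a *: (P f, 0, (P f - f, d)) + (P g, 0, (P g - g, d')) =
    ((a *: P f + P g, a *: (0 : Y) + 0), (a *: (P f - f) + (P g - g), a *: d + d')) by [].
  by rewrite scaler0 addr0 scalerBr addrACA -opprD.
have Pn f : nrm (P f) <= nrm f.
  have [d /((passiveE _).1 V_passive)] := PV f.
  rewrite ripDl ripNl rip_nrm nrm0 expr0n /= sub0r => h.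
  have := rip_le f (P f); have := sqr_ge0 (nrm d).
  have := nrm_ge0 f; have := nrm_ge0 (P f); nra.
have [|f|x xP] := @riesz_representation _ Ho (fun f => inner (P f) w) (nrm w).
- by move=> a f g; rewrite Plin innerDl innerZl.
- apply: le_trans (cmod_inner_le _ _) _; rewrite mulrC.
  by rewrite ler_wpM2l ?nrm_ge0.
have Pk l g : Cplus l -> P ((1 - l) *: ker l g) = ker l g - ker 1 g.
  move=> lp; apply: (PE _ _ (psi l g - psi 1 g)).
  have h1 : V ((ker l g, g), (l *: ker l g, psi l g)) by exact: generated_gen.
  have h2 : V ((ker 1 g, g), (1 *: ker 1 g, psi 1 g)) by exact/generated_gen/Cplus1.
  have := lin_subspaceB V_lin h1 h2.
  have -> : (ker l g, g, (l *: ker l g, psi l g)) - (ker 1 g, g, (1 *: ker 1 g, psi 1 g)) =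
    ((ker l g - ker 1 g, g - g), (l *: ker l g - 1 *: ker 1 g, psi l g - psi 1 g)) by [].
  rewrite subrr scale1r; congr (V (_, (_, _))).
  by rewrite scalerBl scale1r opprB addrCA addrAC subrr add0r.
(* Evaluating [x - w = m x - y] at [m = 1] leaves only [y = w(1)]; away from 1, [x] is then the
   difference quotient [(w(m) - w(1)) / (1 - m)]. *)
exists x, (eo 1 w) => m mp /=.
rewrite phi0 // addr0 linearB /=.
suff E : eo m w - eo 1 w = (1 - m) *: eo m x.
  have : eo m w = (1 - m) *: eo m x + eo 1 w by rewrite -E subrK.
  move=> ->; rewrite scalerBl scale1r opprD addrA opprB addrCA subrr addr0.
  by [].
apply: inner_inj => g; rewrite innerC [RHS]innerC; congr (_^*).
have mp' := CplusJ mp; have := xP ((1 - m^*) *: ker m^* g).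
rewrite Pk // innerBl innerZl => /(congr1 (@Num.conj R[i])).
rewrite rmorphB rmorphM rmorphB rmorph1 /= -!innerC conjcc /ker conjcc rmorph1.
rewrite !(rkhs_adjointE rkhs) ?innerBl ?innerZl //; exact: Cplus1.
Qed.

(** If [w] is orthogonal to the domain, it is orthogonal to its own resolvent vector [x], so
    dissipativity at [(x, x - w)] reads [2 |x|^2 <= - |y|^2]. Hence [x] and [y] vanish, and so does
    [w]. *)
Lemma model_o_dom_dense : dense [set x | exists z, main_op So (x, z)].
Proof.
apply: dense_orthogonal => [|w wA].
  split; first by exists 0, 0; exact: model_o_lin.1.
  move=> a x x' [z [y Sx]] [z' [y' Sx']]; exists (a *: z + z'), (a *: y + y').
  have := model_o_lin.2 a _ _ Sx Sx'.
  have -> : a *: (x, 0, (z, y)) + (x', 0, (z', y')) =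
    ((a *: x + x', a *: (0 : U) + 0), (a *: z + z', a *: y + y')) by [].
  by rewrite scaler0 addr0.
have [x [y Sx]] := model_o_main_range w.
have wx : rip w x = 0 by rewrite /rip wA //; exists (x - w), y.
have := model_o_dissipative Sx; rewrite ripDl ripNl wx subr0 rip_nrm => h.
have x0 : x = 0 by apply: nrm_le0; have := nrm_ge0 x; have := sqr_ge0 (nrm y); nra.
have y0 : y = 0.
  by apply: nrm_le0; rewrite x0 nrm0 in h; have := nrm_ge0 y; nra.
have [_ ext _] := rkhs; apply: ext => m mp; have := Sx m mp.
rewrite /= x0 y0 phi0 // sub0r linearN !linear0 !addr0.
by move=> /eqP; rewrite oppr_eq0 => /eqP.
Qed.

End ObservableModel.

(** * Input and output maps *)

Lemma unitary_range (R : realType) (V W : hilbertType R) (E : V -> W) w :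
  unitary E -> exists v, E v = w.
Proof. by move=> [_ Ew]; exists (adjoint E w). Qed.

Lemma range_lin (R : realType) (V W : hilbertType R) (E : {linear V -> W}) :
  lin_subspace (range E).
Proof.
split=> [|a _ _ [f _ <-] [g _ <-]]; first by exists 0; rewrite ?linear0.
by exists (a *: f + g); rewrite ?linearP.
Qed.

Lemma unitaryP (R : realType) (V W : hilbertType R) (E : {linear V -> W}) :
  contractive E -> dense (range E) -> cancel E (adjoint E) -> unitary E.
Proof.
move=> Ec /(dense_orthogonalP (range_lin E)) Ed EK; split=> // w.
have EP := adjointP (@linearP _ _ _ _ E) Ec.
apply/eqP; rewrite -subr_eq0; apply/eqP/Ed => _ [g _ <-].
by rewrite innerBl EP EK (innerC w) EP -innerC subrr.
Qed.

Section InputMap.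
Variables (R : realType) (U X Y : hilbertType R).
Variable S : set ((X * U) * (X * Y)).
Hypotheses (nodeS : system_node S) (passS : passive S).
Variables (E : extrapolation_space (main_op S)) (B : {linear U -> E}).
Hypothesis ctrlB : control_op B.
Variable phi : R[i] -> U -> Y.
Hypothesis phiE : forall l nu, Cplus l -> phi l nu = transfer B l nu.
Variables (Hc : hilbertType R) (ec : R[i] -> {linear Hc -> U}).
Hypothesis rkhs_c : is_rkhs ec (kernel_c phi).
Variable frakB : {linear Hc -> X}.
Hypothesis inB : is_input_map B ec frakB.

Let ker l nu := adjoint (ec l^*) nu.
Let ir := input_resolvent B.
Let gen l nu (lp : Cplus l) := node_gen nodeS passS ctrlB phiE nu lp.
Let S_lin : lin_subspace S. Proof. by have [[]] := nodeS. Qed.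
Let S_closed : closed S. Proof. by have [] := nodeS. Qed.

Let frakB_contr : contractive frakB. Proof. exact: inB.1. Qed.

Let frakB_ker l nu : Cplus l -> frakB (ker l nu) = ir l nu.
Proof. by move=> lp; exact: inB.2. Qed.

Let frakB_adj : forall f x, inner (frakB f) x = inner f (adjoint frakB x).
Proof. by apply: adjointP => //; exact: linearP. Qed.

Lemma input_map_kernel_gram l m nu mu : Cplus l -> Cplus m ->
  (l + m^*) * inner (ker l nu) (ker m mu) = inner nu mu - inner (phi l nu) (phi m mu).
Proof.
move=> lp mp; have lp' := CplusJ lp; have mp' := CplusJ mp.
rewrite (rkhs_adjointE rkhs_c) // (rkhs_adjoint_ev rkhs_c) // /kernel_c !conjcc.
rewrite innerZl innerBl (addrC l) mulrA mulfV ?mul1r ?CplusD_neq0 //.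
congr (_ - _); rewrite innerC [RHS]innerC; congr (_^*).
by rewrite (transfer_adjoint nodeS passS ctrlB phiE).
Qed.

Lemma input_map_graph x u z y :
  model_c phi ec ((x, u), (z, y)) -> S ((frakB x, u), (frakB z, y)).
Proof.
move=> Sc; pose N := [set p : (Hc * U) * (Hc * Y) |
  S ((frakB p.1.1, p.1.2), (frakB p.2.1, p.2.2))].
suff : closure (lspan [set p | exists l nu, Cplus l /\
    let k := adjoint (ec (l^*)) nu in p = ((k, nu), (l *: k, phi l nu))]) `<=` N.
  by move=> /(_ _ Sc).
apply: closure_sub.
  apply: closed_nrmP => -[[x1 u1] [z1 y1]] pN; apply: S_closed; apply/closure_nrmP => e.
  move=> /pN[[[x2 u2] [z2 y2]] Nq pq]; exists ((frakB x2, u2), (frakB z2, y2)) => //=.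
  apply: le_lt_trans pq.
  have -> : (frakB x1, u1, (frakB z1, y1)) - (frakB x2, u2, (frakB z2, y2)) =
    ((frakB x1 - frakB x2, u1 - u2), (frakB z1 - frakB z2, y1 - y2)) by [].
  have -> : (x1, u1, (z1, y1)) - (x2, u2, (z2, y2)) =
    ((x1 - x2, u1 - u2), (z1 - z2, y1 - y2)) by [].
  have Bn (a b : Hc) : nrm (frakB a - frakB b) <= nrm (a - b).
    by rewrite -linearB; move/contractive_nrm: frakB_contr.
  by rewrite !nrm_pairE !ge_max !le_max !lexx !Bn !orbT.
apply: lspan_sub.
  split=> [|a p q Np Nq]; first by rewrite /N /= linear0; exact: S_lin.1.
  by rewrite /N /= !linearP; exact: (S_lin.2 a _ _ Np Nq).
move=> _ [l [nu [lp ->]]]; rewrite /N /= linearZ /= -/(ker l nu) frakB_ker //.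
exact: gen.
Qed.

Lemma input_map_isometric : energy_preserving S -> cancel frakB (adjoint frakB).
Proof.
move=> /(energy_kform S_lin) Se f.
have kk l m nu mu : Cplus l -> Cplus m ->
    inner (ir l nu) (ir m mu) = inner (ker l nu) (ker m mu).
  move=> lp mp; have := Se _ _ (gen nu lp) (gen mu mp).
  rewrite /kform /= innerZl innerZr -mulrDl => /eqP.
  rewrite addrAC -[X in X + _ - _]opprK.
  move=> h; apply: (mulfI (CplusD_neq0 lp (CplusJ mp))).
  rewrite input_map_kernel_gram //; move: h; rewrite opprK.
  by rewrite subr_eq0 => /eqP <-; rewrite addrK.
(* Kernel functions are fixed first; self-adjointness of the product of [frakB] with its adjoint
   then moves it onto the kernel functions against which a general [f] is tested. *)
have ker_fix l nu : Cplus l -> adjoint frakB (frakB (ker l nu)) = ker l nu.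
  move=> lp; apply: (rkhs_ext rkhs_c) => m mu mp.
  rewrite innerC -frakB_adj -innerC.
  rewrite -[m]conjcc -/(ker _ _) !frakB_ker ?kk //; exact: CplusJ.
apply: (rkhs_ext rkhs_c) => m mu mp.
rewrite innerC -frakB_adj -innerC -[m]conjcc -/(ker _ _) frakB_adj ker_fix //.
exact: CplusJ.
Qed.

Lemma controllableP : controllable B <->
  forall w, (forall l nu, Cplus l -> inner w (ir l nu) = 0) -> w = 0.
Proof.
rewrite /controllable dense_lspanP; split=> H w wG; apply: H.
  by move=> _ [l [nu [lp ->]]]; exact: wG.
by move=> l nu lp; apply: wG; exists l, nu.
Qed.

(** As a function, [adjoint frakB w] is given at [m] by pairing [w] with input resolvents at the
    conjugate point, so [rkhs_eq0] tolerates the missing index 1. *)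
Let adj_eq0 w : (forall l nu, Cplus l -> l != 1 -> inner w (ir l nu) = 0) ->
  adjoint frakB w = 0.
Proof.
move=> wi; apply: (rkhs_eq0 rkhs_c (l := 1)) => m mp m1.
apply: inner_inj => nu; rewrite inner0r innerC -(rkhs_adjointE rkhs_c) //.
rewrite innerC -frakB_adj -innerC -[m]conjcc -/(ker _ _) frakB_ker; last exact: CplusJ.
rewrite wi ?rmorph0 //; first exact: CplusJ.
by apply: contra m1 => /eqP/(congr1 (@Num.conj R[i])); rewrite conjcc rmorph1 => ->.
Qed.

Lemma input_map_dense_range : dense (range frakB) <-> controllable B.
Proof.
rewrite (dense_orthogonalP (range_lin frakB)) controllableP; split=> H w wB; apply: H.
  move=> _ [f _ <-]; rewrite innerC frakB_adj adj_eq0 ?inner0r ?rmorph0 //.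
  by move=> l nu lp _; exact: wB.
by move=> l nu lp; apply: wB; rewrite -frakB_ker //; exists (ker l nu).
Qed.

Lemma input_map_unitary : unitary frakB <-> controllable B /\ energy_preserving S.
Proof.
split=> [Bu|[Bc Se]]; last first.
  by apply: unitaryP; [|exact/input_map_dense_range|exact: input_map_isometric].
split.
  apply/input_map_dense_range/dense_nrmP => x e e0.
  have [f fx] := unitary_range x Bu; exists x; first by exists f.
  by rewrite subrr nrm0.
have gram l m nu mu : Cplus l -> Cplus m ->
    (l + m^*) * inner (ir l nu) (ir m mu) = inner nu mu - inner (phi l nu) (phi m mu).
  by move=> lp mp; rewrite -!frakB_ker // frakB_adj Bu.1 input_map_kernel_gram.
have sep w : (forall l nu, Cplus l -> l != 1 -> inner w (ir l nu) = 0) -> w = 0.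
  by move=> /adj_eq0 w0; rewrite -(Bu.2 w) w0 linear0.
have VS : generated_relation ir phi `<=` S.
  apply: closure_sub => //; apply: lspan_sub => // _ [l [nu [lp ->]]].
  exact: gen.
have SV := node_range_max S_lin passS VS (generated_range gram sep).
by move=> x u z y /SV; exact: (generated_energy gram).
Qed.

End InputMap.

Section OutputMap.
Variables (R : realType) (U X Y : hilbertType R).
Variable S : set ((X * U) * (X * Y)).
Hypotheses (nodeS : system_node S) (passS : passive S).
Variables (E : extrapolation_space (main_op S)) (B : {linear U -> E}).
Hypothesis ctrlB : control_op B.
Variable phi : R[i] -> U -> Y.
Hypothesis phiE : forall l nu, Cplus l -> phi l nu = transfer B l nu.
Variables (Ho : hilbertType R) (eo : R[i] -> {linear Ho -> Y}).
Hypothesis rkhs_o : is_rkhs eo (kernel_o phi).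
Variable frakC : {linear X -> Ho}.
Hypothesis outC : is_output_map S eo frakC.

Let ker l g := adjoint (eo l^*) g.
Let psi l g := adjoint (phi l^*) g.
Let S_lin : lin_subspace S. Proof. by have [[]] := nodeS. Qed.
Let phi_adj := transfer_adjoint nodeS passS ctrlB phiE.
Let ker_gram := model_o_gram rkhs_o phi_adj.

Let frakC_adj : forall x f, inner (frakC x) f = inner x (adjoint frakC f).
Proof. by apply: adjointP; [exact: linearP|exact: outC.1]. Qed.

Lemma output_map_graph x u z y :
  S ((x, u), (z, y)) -> model_o phi eo ((frakC x, u), (frakC z, y)).
Proof.
move=> Sx m mp /=.
have Sg := node_gen nodeS passS ctrlB phiE u mp.
(* Subtracting the generator with the same input at the point [m] leaves a zero-input element; in
   [m x - z] the generator cancels, its derivative being [m] times its state. *)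
have := node_sub nodeS Sx Sg; rewrite subrr => /(output_resolventE nodeS passS mp).
rewrite scalerBr opprB addrA subrK -outC.2 // linearB linearZ linearB linearZ /= => Ez.
by rewrite -[LHS](subKr (m *: eo m (frakC x))) Ez opprB addrA.
Qed.

Let q l g := adjoint frakC (ker l g).

(** The model equation at the conjugate of [l], paired with [g], is precisely the adjoint identity
    for this dual generator. *)
Lemma output_map_adjoint_gen l g : Cplus l ->
  node_adjoint S ((q l g, g), (l *: q l g, psi l g)).
Proof.
move=> lp; have lp' := CplusJ lp => -[[x u] [z y]] /output_map_graph/(_ _ lp') /= E1.
rewrite innerZr /q -!frakC_adj !(rkhs_adjointE rkhs_o) // E1.
by rewrite innerBl innerDl innerZl phi_adj // subrK.
Qed.

Lemma output_map_coisometric : co_energy_preserving S -> cancel (adjoint frakC) frakC.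
Proof.
move=> /(energy_kform (node_adjoint_lin S)) Se f.
have kk l m g d : Cplus l -> Cplus m -> inner (q l g) (q m d) = inner (ker l g) (ker m d).
  move=> lp mp.
  have := Se _ _ (output_map_adjoint_gen g lp) (output_map_adjoint_gen d mp).
  rewrite /kform /= innerZl innerZr -mulrDl => /eqP h.
  apply: (mulfI (CplusD_neq0 lp (CplusJ mp))); rewrite ker_gram //.
  by move: h; rewrite addrAC subr_eq0 => /eqP <-; rewrite addrK.
have ker_fix l g : Cplus l -> frakC (q l g) = ker l g.
  move=> lp; apply: (rkhs_ext rkhs_o) => m d mp.
  rewrite frakC_adj -[m]conjcc -/(ker _ _) -/(q _ _) kk //; exact: CplusJ.
apply: (rkhs_ext rkhs_o) => m d mp; have mp' := CplusJ mp.
rewrite frakC_adj innerC -frakC_adj -innerC.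
by rewrite -[m]conjcc -/(ker _ _) -/(q _ _) ker_fix.
Qed.

Lemma output_map_injective : injective frakC <-> observable S.
Proof.
have [_ ext _] := rkhs_o.
have C0 x : (\bigcap_(l in Cplus) [set x | output_resolvent S l x = 0]) x <-> frakC x = 0.
  split=> [xO|Cx l lp /=]; last by rewrite -outC.2 // Cx linear0.
  by apply: ext => m mp; rewrite outC.2 // linear0; exact: xO.
rewrite /observable; split=> [Ci|SO].
  apply/seteqP; split=> x; first by move=> /C0 Cx; apply: Ci; rewrite linear0.
  by move=> ->; apply/C0; rewrite linear0.
move=> x x' Cx; apply/eqP; rewrite -subr_eq0; apply/eqP.
have : [set 0] (x - x') by rewrite -SO; apply/C0; rewrite linearB /= Cx subrr.
by [].
Qed.

Lemma output_map_unitary : unitary frakC <-> observable S /\ co_energy_preserving S.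
Proof.
split=> [Cu|[/output_map_injective Ci Se]]; last first.
  have CK := output_map_coisometric Se; split=> // x.
  by apply: Ci; rewrite CK.
split; first by apply/output_map_injective; exact: can_inj Cu.1.
have gram l m g d : Cplus l -> Cplus m ->
    (l + m^*) * inner (q l g) (q m d) = inner g d - inner (psi l g) (psi m d).
  by move=> lp mp; rewrite /q -frakC_adj Cu.2 ker_gram.
have sep w : (forall l g, Cplus l -> l != 1 -> inner w (q l g) = 0) -> w = 0.
  move=> wq; rewrite -(Cu.1 w) (_ : frakC w = 0).
    by apply: inner_eq0 => x; rewrite innerC -frakC_adj inner0r rmorph0.
  by apply: (model_o_sep rkhs_o) => l g lp l1; rewrite frakC_adj; exact: wq.
have VS : generated_relation q psi `<=` node_adjoint S.
  apply: closure_sub; first exact: node_adjoint_closed.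
  apply: lspan_sub; first exact: node_adjoint_lin.
  by move=> _ [l [g [lp ->]]]; exact: output_map_adjoint_gen.
have Sp : passive (node_adjoint S).
  by apply: passive_adjoint => //; exact: (node_rangeP nodeS passS (xm1_beta_res E)).
have SV := node_range_max (node_adjoint_lin S) Sp VS (generated_range gram sep).
by move=> x u z y /SV; exact: (generated_energy gram).
Qed.

End OutputMap.
Theorem theorem2p8 (R : realType) (U X Y : hilbertType R)
  (sepU : separable_space U) (sepY : separable_space Y)
  (S : set ((X * U) * (X * Y)))
  (nodeS : system_node S) (passS : passive S)
  (E : extrapolation_space (main_op S)) (B : {linear U -> E})
  (ctrlB : control_op B)
  (phi : R[i] -> U -> Y)
  (phiE : forall l nu, Cplus l -> phi l nu = transfer B l nu)
  (Hc Ho : hilbertType R)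
  (ec : R[i] -> {linear Hc -> U}) (rkhs_c : is_rkhs ec (kernel_c phi))
  (eo : R[i] -> {linear Ho -> Y}) (rkhs_o : is_rkhs eo (kernel_o phi))
  (frakB : {linear Hc -> X}) (inB : is_input_map B ec frakB)
  (frakC : {linear X -> Ho}) (outC : is_output_map S eo frakC) :
  let Sc := model_c phi ec in
  let So := model_o phi eo in
  let Gamma : {linear Hc -> Ho} := (frakC \o frakB) in
  [/\
    [/\ intertwines Sc S frakB /\ contractive frakB,
        energy_preserving S -> isometric frakB,
        dense (range frakB) <-> controllable B &
        unitary frakB <-> controllable B /\ energy_preserving S],
    [/\ intertwines S So frakC /\ contractive frakC,
        co_energy_preserving S -> coisometric frakC,
        injective frakC <-> observable S &
        unitary frakC <-> observable S /\ co_energy_preserving S] &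
    [/\ forall (Eo : extrapolation_space (main_op So)) (Bo : {linear U -> Eo}),
          control_op Bo -> is_input_map Bo ec Gamma,
        intertwines Sc So Gamma &
        forall x u z y, Sc ((x, u), (z, y)) ->
          forall m, Cplus m ->
            eo m (Gamma z) = m *: eo m (Gamma x) + phi m u - y]].

Proof.
move=> Sc So Gamma.
have phi_lin := transfer_linear nodeS passS ctrlB phiE.
have phi_adj := transfer_adjoint nodeS passS ctrlB phiE.
have Bc : contractive frakB := inB.1.
have Cc : contractive frakC := outC.1.
have Gc : contractive Gamma by move=> x; apply: le_trans (Cc _) (Bc x).
have BG := input_map_graph nodeS passS ctrlB phiE inB.
have CG := output_map_graph nodeS passS ctrlB phiE outC.
have So_fun := model_o_fun rkhs_o phi_adj.
have GG x u z y : Sc ((x, u), (z, y)) -> So ((Gamma x, u), (Gamma z, y)).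
  by move=> /BG/CG.
have Badj := adjointP (@linearP _ _ _ _ frakB) Bc.
have Cadj := adjointP (@linearP _ _ _ _ frakC) Cc.
split; split.
- by split=> //; apply: intertwines_graph => //; exact: node_fun.
- move=> /(input_map_isometric nodeS passS ctrlB phiE rkhs_c inB) BK.
  apply/isometric_nrm => f; apply/eqP; rewrite -(@eqrXn2 _ 2) ?nrm_ge0 // -!rip_nrm.
  by rewrite {1}/rip Badj BK.
- exact: (input_map_dense_range rkhs_c inB).
- exact: (input_map_unitary nodeS passS ctrlB phiE rkhs_c inB).
- by split=> //; apply: intertwines_graph.
- move=> /(output_map_coisometric nodeS passS ctrlB phiE rkhs_o outC) CK.
  apply/isometric_nrm => f; apply/eqP; rewrite -(@eqrXn2 _ 2) ?nrm_ge0 // -!rip_nrm.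
  by rewrite {1}/rip -Cadj CK.
- exact: (output_map_injective rkhs_o outC).
- exact: (output_map_unitary nodeS passS ctrlB phiE rkhs_o outC).
- move=> Eo Bo ctrlBo; split=> // l nu lp.
  (* [frakC] carries the generator of [S] at [l] to an element of the model graph whose derivative
     is [l] times its state; [input_resolventE] recognizes that state as the input resolvent of the
     model. *)
  have Sx := CG _ _ _ _ (node_gen nodeS passS ctrlB phiE nu lp).
  rewrite linearZ /= in Sx; rewrite /Gamma /= inB.2 //; apply/esym.
  apply: (input_resolventE _ ctrlBo _ Sx).
    exact: (model_o_dom_dense rkhs_o phi_lin phi_adj).
  by move=> x; exact: (model_o_main_eq0 rkhs_o phi_lin lp).
- exact: intertwines_graph.
- by move=> x u z y /GG.
Qed.
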